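(* For each $n = 1, 2, \dots$, let $K_n$ be the closure of the 3-braid $\beta_n = (\sigma_1^{-1})^{2n+3}\,\sigma_2\,(\sigma_1)^3\,\sigma_2$, regarded as a transverse knot. Then Plamenevskaya's transverse invariant satisfies $\psi(K_n) \neq 0$.
   Context: Transverse knots in the standard contact 3-space are represented by closures of braids; $\sigma_1,\sigma_2$ are the standard generators of the 3-strand braid group (each $\sigma_i$ closing up to a positive crossing). Plamenevskaya's invariant: let $\beta$ be an $m$-strand braid word, and $D$ the diagram of its closure $\widehat\beta$. Consider the Khovanov complex of $D$, with $V = \langle v_+, v_-\rangle$ the underlying Frobenius algebra, with multiplication $m(v_+\otimes v_+)=v_+$, $m(v_+\otimes v_-)=m(v_-\otimes v_+)=v_-$, $m(v_-\otimes v_-)=0$ and comultiplication $\Delta(v_+)=v_+\otimes v_-+v_-\otimes v_+$, $\Delta(v_-)=v_-\otimes v_-$. The oriented (braid-like) resolution of $D$, given by the 0-resolution at each positive crossing and the 1-resolution at each negative crossing, consists of $m$ parallel circles. The element $v_-\otimes\cdots\otimes v_-$ ($m$ factors) placed at this resolution is a cycle in the Khovanov complex, and $\psi(\widehat\beta)$ is its homology class in the Khovanov homology $Kh(\widehat\beta)$ (in homological degree $0$ and quantum degree $sl(\widehat\beta)=-m+a$, where $a$ is the exponent sum of $\beta$). Up to sign it is an invariant of the transverse link represented by $\beta$. *)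

(* Defs.v *)
From HB Require Import structures.
From mathcomp Require Import all_boot all_order all_algebra.
From mathcomp Require Import generic_quotient ring_quotient.
From mathcomp Require Import boolp.

Set Implicit Arguments.
Unset Strict Implicit.
Unset Printing Implicit Defensive.

Import GRing.Theory.
Local Open Scope quotient_scope.
Local Open Scope ring_scope.

(* The letter (i, true) is sigma_(i+1), a positive crossing between the       *)
(* strands i and i+1 (counted from 0); (i, false) is its inverse.             *)
Definition braid_word (m : nat) := seq ('I_m * bool).

(* The Frobenius algebra V = <v_+, v_->, by its structure constants in the    *)
(* basis (v_+, v_-).                                                          *)
Definition label := bool.
Definition vplus : label := true.
Definition vminus : label := false.

(* The coefficient of z in m(x (x) y). *)
Definition mul_coef (x y z : label) : int :=
  match x, y, z with
  | true, true, true => 1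
  | true, false, false => 1
  | false, true, false => 1
  | _, _, _ => 0
  end.

(* The coefficient of y (x) z in Delta(x). *)
Definition comul_coef (x y z : label) : int :=
  match x, y, z with
  | true, true, false => 1
  | true, false, true => 1
  | false, false, false => 1
  | _, _, _ => 0
  end.

Section Khovanov.
Variables (m : nat) (w : braid_word m).
Local Notation N := (size w).

(* The closed braid on m.+1 strands is cut at N.+1 levels: crossing k lies    *)
(* between the levels k and k.+1, and the closure arcs join level N to        *)
(* level 0.                                                                   *)
Definition point : finType := ('I_m.+1 * 'I_N.+1)%type.

Definition crossing (k : 'I_N) : 'I_m * bool := tnth (in_tuple w) k.
Definition positive (k : 'I_N) : bool := (crossing k).2.

Definition level_lo (k : 'I_N) : 'I_N.+1 := widen_ord (leqnSn N) k.
Definition level_hi (k : 'I_N) : 'I_N.+1 := lift ord0 k.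
Definition strand_l (k : 'I_N) : 'I_m.+1 := widen_ord (leqnSn m) (crossing k).1.
Definition strand_r (k : 'I_N) : 'I_m.+1 := lift ord0 (crossing k).1.

Definition corner_sw k : point := (strand_l k, level_lo k).
Definition corner_se k : point := (strand_r k, level_lo k).
Definition corner_nw k : point := (strand_l k, level_hi k).
Definition corner_ne k : point := (strand_r k, level_hi k).

(* a k = false is the 0-resolution at the crossing k, a k = true is the       *)
(* 1-resolution.                                                              *)
Definition resolution : finType := {ffun 'I_N -> bool}.

(* The braid-like smoothing is the 0-resolution of a positive crossing and    *)
(* the 1-resolution of a negative one.                                        *)
Definition braidlike (a : resolution) (k : 'I_N) : bool := a k == ~~ positive k.

Definition arc (a : resolution) (x y : point) : bool :=
  [|| [&& x.1 == y.1, x.2 == ord0 & y.2 == ord_max],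
      [exists k, [&& x.1 == y.1, x.2 == level_lo k, y.2 == level_hi k
                   & braidlike a k || (x.1 \notin [:: strand_l k; strand_r k])]]
    | [exists k, ~~ braidlike a k &&
         (((x == corner_sw k) && (y == corner_se k))
          || ((x == corner_nw k) && (y == corner_ne k)))]].

(* The circles of the resolved diagram are the classes of this relation. *)
Definition same_circle (a : resolution) : rel point :=
  connect (fun x y => arc a x y || arc a y x).

(* A labelling of the circles, seen as a function on points. *)
Definition circle_labelling (a : resolution) (f : {ffun point -> label}) : bool :=
  [forall x, forall y, same_circle a x y ==> (f x == f y)].

Definition state : finType :=
  {s : resolution * {ffun point -> label} | circle_labelling s.1 s.2}.
Definition res (s : state) : resolution := (val s).1.
Definition lab (s : state) : {ffun point -> label} := (val s).2.

(* The free abelian group on the states, i.e. the direct sum of all the       *)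
(* bidegrees of the complex.                                                  *)
Definition chain : zmodType := {ffun state -> int}.

Definition flip (a : resolution) (k : 'I_N) : resolution :=
  [ffun j => (j == k) || a j].

(* The coefficient of t in the image of s by the merge or split at the        *)
(* crossing k (unsigned). In either smoothing of k, the south-west and        *)
(* north-east corners lie on the two different arcs, so that their circles    *)
(* are the ones involved in the surgery, both before and after it.            *)
Definition surgery_coef (k : 'I_N) (s t : state) : int :=
  let p := corner_sw k in let q := corner_ne k in
  let a := res s in let f := lab s in let g := lab t in
  if [forall x, [|| same_circle a x p, same_circle a x q | f x == g x]] then
    if same_circle a p q then comul_coef (f p) (g p) (g q)
    else mul_coef (f p) (f q) (g p)
  else 0.

Definition diff_coef (s t : state) : int :=
  \sum_(k < N | ~~ res s k && (res t == flip (res s) k))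
    (-1) ^+ #|[set j : 'I_N | (j < k)%N && res s j]| * surgery_coef k s t.

Definition differential (x : chain) : chain :=
  [ffun t => \sum_s x s * diff_coef s t].

Fact differential_is_zmod_morphism : zmod_morphism differential.
Proof.
move=> x y; apply/ffunP => t; rewrite !ffunE -sumrB.
by apply: eq_bigr => s _; rewrite !ffunE mulrBl.
Qed.
HB.instance Definition _ :=
  GRing.isZmodMorphism.Build chain chain differential
    differential_is_zmod_morphism.

Definition is_cycle : {pred chain} := [pred x | differential x == 0].

Fact is_cycle_zmod_closed : zmod_closed is_cycle.
Proof.
split=> [|x y]; rewrite !inE ?raddf0 // => /eqP dx /eqP dy.
by rewrite (raddfB differential) /= dx dy subrr.
Qed.
HB.instance Definition _ :=
  GRing.isZmodClosed.Build chain is_cycle is_cycle_zmod_closed.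

Record cycles := Cycle { cycle_val :> chain; cycleP : cycle_val \in is_cycle }.
HB.instance Definition _ := [isSub for cycle_val].
HB.instance Definition _ := [Choice of cycles by <:].
HB.instance Definition _ := [SubChoice_isSubZmodule of cycles by <:].

Definition is_boundary : {pred cycles} :=
  [pred z : cycles | `[< exists x : chain, differential x = z >]].

Fact is_boundary_zmod_closed : zmod_closed is_boundary.
Proof.
split=> [|z1 z2]; first by rewrite inE; apply/asboolP; exists 0; rewrite !raddf0.
rewrite !inE => /asboolP[x1 d1] /asboolP[x2 d2]; apply/asboolP.
by exists (x1 - x2); rewrite !raddfB /= d1 d2.
Qed.
HB.instance Definition _ :=
  GRing.isZmodClosed.Build cycles is_boundary is_boundary_zmod_closed.

(* Total Khovanov homology (the direct sum over all bidegrees). *)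
Definition Kh : zmodType := Quotient.quot is_boundary.

Definition oriented_resolution : resolution := [ffun k => ~~ positive k].

Fact all_vminus_labelling :
  circle_labelling oriented_resolution [ffun=> vminus].
Proof. by apply/forallP => x; apply/forallP => y; rewrite !ffunE eqxx implybT. Qed.

Definition psi_state : state :=
  exist (fun s : resolution * {ffun point -> label} => circle_labelling s.1 s.2)
    (oriented_resolution, [ffun=> vminus]) all_vminus_labelling.

Definition psi_chain : chain := [ffun s => (s == psi_state)%:R].

Lemma same_circle_oriented (x y : point) :
  same_circle oriented_resolution x y -> x.1 = y.1.
Proof.
have arc1 (u v : point) : arc oriented_resolution u v -> u.1 = v.1.
  case/or3P => [/and3P[/eqP]//|/existsP[k /and4P[/eqP]]//|/existsP[k]].
  by rewrite /braidlike ffunE eqxx.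
case/connectP => p; elim: p x => [|z p IHp] x /=; first by move=> _ ->.
by move=> /andP[xz /IHp pz] /pz <-; case/orP: xz => /arc1.
Qed.

Lemma psi_chain_cycle : psi_chain \in is_cycle.
Proof.
rewrite inE; apply/eqP/ffunP => t; rewrite !ffunE big1 // => s _.
rewrite ffunE; case: eqP => [->|_]; last by rewrite mul0r.
rewrite mul1r /diff_coef big1 // => k _; rewrite /surgery_coef.
case: ifP => _; last by rewrite mulr0.
rewrite /res /lab /=; case: ifP => [/same_circle_oriented/(congr1 val)/=|_].
  by rewrite /bump /= add1n => /n_Sn.
by rewrite !ffunE mulr0.
Qed.

(* Plamenevskaya's invariant of the closure of w. *)
Definition psi : Kh := \pi_(Quotient.quot is_boundary) (Cycle psi_chain_cycle).

Lemma psi_eq0 : psi = 0 <-> exists x : chain, differential x = psi_chain.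
Proof.
have -> : (psi = 0) <-> (Cycle psi_chain_cycle \in is_boundary).
  rewrite -[Cycle _]subr0 Quotient.idealrBE /psi.
  have -> : (0 : Kh) = \pi_(Quotient.quot is_boundary) 0.
    by rewrite (raddf0 \pi_(Quotient.quot is_boundary)).
  by split => /eqP.
by rewrite inE; split => [/asboolP|H]; last apply/asboolP.
Qed.

End Khovanov.

Definition sigma1 : 'I_2 * bool := (ord0, true).
Definition sigma2 : 'I_2 * bool := (ord_max, true).
Definition sigma1_inv : 'I_2 * bool := (ord0, false).

Definition beta (n : nat) : braid_word 2 :=
  nseq (2 * n + 3)%N sigma1_inv ++ [:: sigma2] ++ nseq 3 sigma1 ++ [:: sigma2].

(* Main.v *)
Require Import Defs.
From mathcomp Require Import all_boot all_algebra zify.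

(* The invariant is nonzero already mod 2. Let T = 2n+3, and call a negative
   crossing in its 0-resolution a turnback. A resolution with j >= 1 turnbacks
   cuts the twist region of the T negative crossings into j-1 small circles and
   two ends. Capping the small circles by the counit (v_- to 1, v_+ to 0) maps
   the complex of the twist, mod 2, onto its minimal model
       ... -> e -> e -> e -> 1,
   where e is a single turnback, the last map is a saddle and each of the
   others is the sum of the multiplications by v_- at the two ends. The
   closure of this model with the five positive crossings does not depend on
   n, and a functional on it that kills boundaries and is 1 on psi is found by
   linear algebra over F_2 (it is listed in [support]). *)

Set Implicit Arguments.
Unset Strict Implicit.
Unset Printing Implicit Defensive.

Import GRing.Theory.
Local Notation arc := Defs.arc.

Local Open Scope ring_scope.

(** * Merges and splits *)

(** The obstacle is that the diagram grows with n while the linear algebra has to be a single finite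
    computation. The homological degree removes n: psi lies in degree 0, where there are as many
    turnbacks as 1-resolved positive crossings, and boundaries come from degree -1, where there is
    one turnback more. So the five positive bits alone select the term of the minimal model. Capping
    respects the differential for two reasons. A small circle labelled v_+ can be merged away on
    either side with the same result, so these two contributions cancel, and every other surgery
    leaves it to be killed by the counit. If all small circles are labelled v_-, an inner turnback
    multiplies v_- by v_-, which is 0, so only the two outermost ones contribute. Over the integers
    the two multiplications by v_- would be added and subtracted alternately; mod 2 one formula
    serves every stage. *)

Section Surgery.
Variables (m : nat) (w : braid_word m).
Local Notation N := (size w).
Implicit Types (a b : resolution w) (x y : point w) (k : 'I_N) (s t : state w).

Lemma same_circle_refl a x : same_circle a x x.
Proof. exact: connect0. Qed.

Lemma same_circleC a x y : same_circle a x y = same_circle a y x.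
Proof. by apply: sym_connect_sym => u v; rewrite /= orbC. Qed.

Lemma same_circle_trans a : transitive (same_circle a).
Proof. exact: connect_trans. Qed.

Lemma same_circle_eql a x y z :
  same_circle a x y -> same_circle a x z = same_circle a y z.
Proof.
move=> xy; apply/idP/idP; last exact: same_circle_trans xy.
by apply: same_circle_trans; rewrite same_circleC.
Qed.

Lemma arc_same_circle a x y : arc a x y -> same_circle a x y.
Proof. by move=> h; apply: connect1; rewrite h. Qed.

Lemma same_circle_inv (T : Type) (g : point w -> T) a x y :
    (forall u v, arc a u v -> g u = g v) ->
  same_circle a x y -> g x = g y.
Proof.
move=> gP /connectP[p]; elim: p x => [|z p IH] x /=; first by move=> _ ->.
by case/andP => /orP[/gP->|/gP<-] /IH.
Qed.

Lemma same_circle_sub (e : rel (point w)) a x y :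
    reflexive e -> symmetric e -> transitive e -> (forall u v, arc a u v -> e u v) ->
  same_circle a x y -> e x y.
Proof.
move=> er es et eP /connectP[p]; elim: p x => [|z p IH] x /=; first by move=> _ ->.
case/andP => h pz yl; apply: (et z); last exact: IH.
by case/orP: h => /eP //; rewrite es.
Qed.

Definition corners k : seq (point w) :=
  [:: corner_sw k; corner_se k; corner_nw k; corner_ne k].

Lemma corners_same_circle a k x : x \in corners k ->
  same_circle a x (corner_sw k) || same_circle a x (corner_ne k).
Proof.
have vert (s : 'I_m.+1) : s \in [:: strand_l k; strand_r k] -> braidlike a k ->
    same_circle a (s, level_lo k) (s, level_hi k).
  move=> sk ak; apply: arc_same_circle; apply/or3P/Or32/existsP; exists k.
  by rewrite !eqxx ak.
have hor : ~~ braidlike a k -> same_circle a (corner_sw k) (corner_se k) /\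
    same_circle a (corner_nw k) (corner_ne k).
  move=> ak; split; apply: arc_same_circle; apply/or3P/Or33/existsP;
  by exists k; rewrite ak !eqxx ?orbT.
rewrite !inE => /or4P[] /eqP->; rewrite ?same_circle_refl ?orbT //;
  case: (boolP (braidlike a k)) => [/vert h|/hor[h1 h2]].
- by rewrite h ?orbT // !inE eqxx orbT.
- by rewrite same_circleC h1.
- by rewrite same_circleC h // !inE eqxx.
- by rewrite h2 orbT.
Qed.

Lemma arc_off_crossing a b k x y :
    (forall j, j != k -> a j = b j) -> arc a x y ->
  arc b x y || (x \in corners k) && (y \in corners k).
Proof.
move=> ab; have bl j : j != k -> braidlike a j = braidlike b j.
  by move=> jk; rewrite /braidlike ab.
case/or3P => [h|/existsP[j]|/existsP[j]]; first by rewrite /arc h.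
- have [->|jk] := eqVneq j k; last first.
    move=> h; apply/orP; left; apply/or3P/Or32/existsP; exists j.
    by rewrite -bl.
  case/and4P => /eqP x1 /eqP x2 /eqP y2 h.
  have [xk|xk] := boolP (x.1 \in [:: strand_l k; strand_r k]); last first.
    apply/orP; left; apply/or3P/Or32/existsP; exists k.
    by rewrite x1 x2 y2 !eqxx -x1 xk orbT.
  apply/orP; right; move: x1 x2 y2 xk; case: x y {h} => [x1 x2] [y1 y2] /= -> -> ->.
  rewrite !inE !xpair_eqE !eqxx /=.
  by case/orP => ->; rewrite ?orbT ?andbT ?orbT.
have [->|jk] := eqVneq j k; last first.
  move=> h; apply/orP; left; apply/or3P/Or33/existsP; exists j.
  by rewrite -bl.
case/andP => _ /orP[] /andP[/eqP-> /eqP->]; rewrite !inE !eqxx ?orbT //.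
Qed.

(* In either smoothing every corner of the crossing k shares a circle with the
   south-west or the north-east one. Hence to compare the circles before and
   after a surgery it is enough to know whether these two share a circle. *)
Lemma same_circle_off_crossing a b k x y :
    (forall j, j != k -> a j = b j) -> same_circle a x y ->
  same_circle b x y || 
  (same_circle b x (corner_sw k) || same_circle b x (corner_ne k)) &&
  (same_circle b y (corner_sw k) || same_circle b y (corner_ne k)).
Proof.
move=> ab; set c := fun x => same_circle b x (corner_sw k) || same_circle b x (corner_ne k).
have cE u v : same_circle b u v -> c u = c v.
  by move=> uv; rewrite /c; congr (_ || _); apply: (same_connect _ uv) => ? ?;
     apply: same_circleC.
apply: (@same_circle_sub (fun x y => same_circle b x y || c x && c y)).
- by move=> u; rewrite same_circle_refl.
- by move=> u v; rewrite same_circleC andbC.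
- move=> v u z /orP[uv|/andP[cu cv]] /orP[vz|/andP[cv' cz]].
  + by rewrite (same_circle_trans uv vz).
  + by rewrite (cE _ _ uv) cv' cz orbT.
  + by rewrite cu -(cE _ _ vz) cv orbT.
  + by rewrite cu cz orbT.
move=> u v /(arc_off_crossing ab) /orP[/arc_same_circle->//|/andP[uk vk]].
by rewrite /c !corners_same_circle ?orbT.
Qed.

Lemma flip_off_crossing a k : forall j, j != k -> a j = flip a k j.
Proof. by move=> j /negbTE jk; rewrite ffunE jk. Qed.

Lemma circle_labellingP a (f : {ffun point w -> label}) :
  reflect (forall x y, same_circle a x y -> f x = f y) (circle_labelling a f).
Proof.
apply: (iffP forallP) => [h x y xy|h x].
  by apply/eqP; move/(_ x)/forallP/(_ y): h; rewrite xy.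
by apply/forallP => y; apply/implyP => /h ->.
Qed.

Lemma lab_same_circle s x y : same_circle (res s) x y -> lab s x = lab s y.
Proof. exact: (elimT (circle_labellingP _ _) (valP s)). Qed.

(** Conjunction of labels is the multiplication of V as long as one factor is v_+; the vanishing
    product of two v_- is accounted for by the factor [||] in [merge_flux]. *)
Definition merged a k (f : {ffun point w -> label}) : {ffun point w -> label} :=
  [ffun x => if same_circle a x (corner_sw k) || same_circle a x (corner_ne k)
    then f (corner_sw k) && f (corner_ne k) else f x].

(** Both circles created by a split inherit the label of the old one; turning one of two v_+ into
    v_- gives one term of the comultiplication of v_+. *)
Definition set_minus b (f : {ffun point w -> label}) y : {ffun point w -> label} :=
  [ffun x => ~~ same_circle b x y && f x].

(** Sums of booleans are taken in F_2. A state is determined by its resolution and its labels, so at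
    most one summand survives. *)
Lemma sum_state_eq b (f : {ffun point w -> label}) (g : state w -> bool) :
    (forall t, res t = b -> g t -> lab t = f) -> forall hf : circle_labelling b f,
  \sum_(t | res t == b) g t = g (exist _ (b, f) hf).
Proof.
move=> gP hf; rewrite (bigD1 (exist _ (b, f) hf : state w)) /res ?eqxx //=.
rewrite big1 ?addr0 // => t /andP[/eqP tb tf]; apply/negbTE/negP => /(gP _ tb) lf.
by case/eqP: tf; apply: val_inj => /=; case: t tb lf => -[? ?] h; rewrite /res /lab /= => -> ->.
Qed.

Variables (F : resolution w -> {ffun point w -> label} -> bool).

Let flux k s := \sum_(t | res t == flip (res s) k)
  (surgery_coef k s t)%:~R * F (res t) (lab t).

Lemma merge_flux k s : let a := res s in let f := lab s in
    ~~ same_circle a (corner_sw k) (corner_ne k) ->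
    same_circle (flip a k) (corner_sw k) (corner_ne k) ->
  flux k s = (f (corner_sw k) || f (corner_ne k)) && F (flip a k) (merged a k f).
Proof.
move=> a f; set p := corner_sw k; set q := corner_ne k; set b := flip a k => apq bpq.
have sub x y : same_circle a x y -> same_circle b x y.
  move=> /(same_circle_off_crossing (@flip_off_crossing a k)) /orP[//|].
  rewrite -/p -/q -/b => /andP[]; have qp := bpq; rewrite same_circleC in qp.
  have toq z : same_circle b z p || same_circle b z q -> same_circle b z q.
    by case/orP => // /same_circle_trans; apply.
  move=> /toq xq /toq; rewrite same_circleC; exact: same_circle_trans xq.
have inb x : same_circle a x p || same_circle a x q -> same_circle b x p.
  case/orP => /sub // /same_circle_trans; apply; by rewrite same_circleC.
have lf : circle_labelling b (merged a k f).
  apply/circle_labellingP => x y; rewrite !ffunE -/p -/q.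
  have ba j : j != k -> b j = a j by move=> jk; rewrite -(flip_off_crossing a jk).
  move=> /(same_circle_off_crossing ba) /orP[xy|/andP[-> ->]//].
  by rewrite !(same_circle_eql _ xy) (lab_same_circle xy).
rewrite /flux (@sum_state_eq b (merged a k f) _ _ lf) => [|t tb].
- rewrite /= /surgery_coef -/a -/f -/p -/q (negbTE apq) /res /lab /=.
  case: ifP => [_|/negP[]]; last first.
    apply/forallP => x; rewrite !ffunE -/p -/q.
    by case: ifP => [/orP[]->|]; rewrite ?orbT ?eqxx ?orbT.
  rewrite ffunE -/p -/q same_circle_refl /=.
  by case: (f p) (f q) => [] [] //=; case: (F _ _).
- rewrite /surgery_coef -/a -/f -/p -/q (negbTE apq).
  case: ifP => [/forallP out|]; last by rewrite mul0r.
  have [e _|/eqP ne] := eqVneq (lab t p) (f p && f q); last first.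
    by move: ne; case: (f p) (f q) (lab t p) => [] [] [].
  apply/ffunP => x; rewrite !ffunE -/p -/q; case: ifP => [/inb xp|].
    by rewrite -e; apply: lab_same_circle; rewrite tb.
  by move/(_ x): out; rewrite orbA => /orP[->//|/eqP->].
Qed.

Lemma split_flux k s : let a := res s in let f := lab s in let b := flip a k in
    same_circle a (corner_sw k) (corner_ne k) ->
    ~~ same_circle b (corner_sw k) (corner_ne k) ->
  flux k s = if f (corner_sw k)
    then F b (set_minus b f (corner_sw k)) + F b (set_minus b f (corner_ne k))
    else F b f.
Proof.
move=> a f b; set p := corner_sw k; set q := corner_ne k => apq bpq.
have qp := apq; rewrite same_circleC in qp.
have ba j : j != k -> b j = a j by move=> jk; rewrite -(flip_off_crossing a jk).
have sub x y : same_circle b x y -> same_circle a x y.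
  move=> /(same_circle_off_crossing ba) /orP[//|].
  rewrite -/p -/q => /andP[].
  have toq z : same_circle a z p || same_circle a z q -> same_circle a z q.
    by case/orP => // /same_circle_trans; apply.
  move=> /toq xq /toq; rewrite same_circleC; exact: same_circle_trans xq.
have ina x : same_circle a x p -> same_circle b x p || same_circle b x q.
  move=> /(same_circle_off_crossing (@flip_off_crossing a k)) /orP[->//|].
  by rewrite -/p -/q -/b => /andP[].
have fqp : f q = f p by apply: lab_same_circle.
have lfm y : circle_labelling b (set_minus b f y).
  apply/circle_labellingP => x z xz; rewrite !ffunE.
  by rewrite (same_circle_eql _ xz) (lab_same_circle (sub _ _ xz)).
have lf : circle_labelling b f.
  by apply/circle_labellingP => x z /sub /lab_same_circle.
have E t (g : {ffun point w -> label}) : res t = b ->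
    (forall x, ~~ same_circle a x p -> g x = f x) ->
    (forall x y, same_circle b x y -> g x = g y) ->
    [forall x, [|| same_circle a x p, same_circle a x q | f x == lab t x]] ->
    lab t p = g p -> lab t q = g q -> lab t = g.
  move=> tb gf gc /forallP out tp tq; apply/ffunP => x.
  have tc u v : same_circle b u v -> lab t u = lab t v.
    by rewrite -tb; apply: lab_same_circle.
  have [/ina/orP[] xp|xp] := boolP (same_circle a x p).
  - by rewrite (tc _ _ xp) (gc _ _ xp).
  - by rewrite (tc _ _ xp) (gc _ _ xp).
  rewrite gf //; move/(_ x): out; rewrite (negbTE xp) /= => /orP[/same_circle_trans h|/eqP->//].
  by rewrite h in xp.
have O (g : {ffun point w -> label}) : (forall x, ~~ same_circle a x p -> g x = f x) ->
    [forall x, [|| same_circle a x p, same_circle a x q | f x == g x]].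
  by move=> h; apply/forallP => x; case: (boolP (same_circle a x p)) => //= /h ->; rewrite eqxx orbT.
have mf y : same_circle a y p -> forall x, ~~ same_circle a x p -> set_minus b f y x = f x.
  move=> yp x xp; rewrite ffunE; case: (boolP (same_circle b x y)) => //= /sub xy.
  by rewrite (same_circle_trans xy yp) in xp.
have mc y x z : same_circle b x z -> set_minus b f y x = set_minus b f y z.
  by move: x z; apply/circle_labellingP.
have mE : [/\ set_minus b f p p = false, set_minus b f p q = f p,
    set_minus b f q p = f p & set_minus b f q q = false].
  rewrite !ffunE !same_circle_refl /= fqp (negbTE bpq).
  by rewrite same_circleC (negbTE bpq).
case: mE => mpp mpq mqp mqq.
have pp := same_circle_refl a p.
rewrite /flux; case: ifP => fp; last first.
  rewrite (@sum_state_eq b f _ _ lf) => [|t tb].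
    by rewrite /surgery_coef -/a -/f -/p -/q apq /res /lab /= O //= fqp fp /= mul1r.
  rewrite /surgery_coef -/a -/f -/p -/q apq; case: ifP => out; last by rewrite mul0r.
  rewrite fp /= => h; apply: (E _ _ tb) => //; first exact/circle_labellingP.
    by rewrite fp; move: h; case: (lab t p) => //; case: (lab t q).
  by rewrite fqp fp; move: h; case: (lab t p) => //; case: (lab t q).
(* The two terms of the comultiplication of v_+ are told apart by the label at [p]; splitting the
   sum accordingly leaves one target in each half. *)
pose g u t := (lab t p == u) && ((surgery_coef k s t)%:~R * F (res t) (lab t)).
rewrite (eq_bigr (fun t => g false t + g true t)); last first.
  by move=> t _; rewrite /g; case: (lab t p); case: (_ * _).
rewrite big_split /=.
rewrite (@sum_state_eq b (set_minus b f p) (g false) _ (lfm p)); last first.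
  move=> t tb; rewrite /g => /andP[/eqP tp].
  rewrite /surgery_coef -/a -/f -/p -/q apq; case: ifP => out; last by rewrite mul0r.
  rewrite fp tp; case tq: (lab t q) => // _; apply: (E _ _ tb) => //; try exact: mf; try exact: mc.
    by rewrite mpp.
  by rewrite mpq fp.
rewrite (@sum_state_eq b (set_minus b f q) (g true) _ (lfm q)); last first.
  move=> t tb; rewrite /g => /andP[/eqP tp].
  rewrite /surgery_coef -/a -/f -/p -/q apq; case: ifP => out; last by rewrite mul0r.
  rewrite fp tp; case tq: (lab t q) => // _; apply: (E _ _ tb) => //; try exact: mf; try exact: mc.
    by rewrite mqp fp.
  by rewrite mqq.
rewrite /g /surgery_coef -/a -/f -/p -/q apq /res /lab /= O ?O; try exact: mf.
by rewrite fp mpp mpq mqp mqq fp /= !mul1r.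
Qed.

(** An integral chain bounding psi would bound it mod 2; pairing both sides with [F] gives 1 = 0. As
    -1 = 1 in F_2, unsigned surgeries out of one state at a time are all that has to be examined. *)
Lemma psi_neq0_of_functional :
    (forall s, \sum_(k | ~~ res s k) flux k s = 0) ->
    F (oriented_resolution w) [ffun=> vminus] ->
  psi w <> 0.
Proof.
move=> F0 Fpsi /psi_eq0 [x dx].
have sgn n : ((-1) ^+ n : bool) = 1 by elim: n => // n IH; rewrite exprS IH.
have d0 s : \sum_t (diff_coef s t)%:~R * F (res t) (lab t) = 0 :> bool.
  rewrite -[RHS](F0 s) /flux.
  under [in RHS]eq_bigr do rewrite big_mkcond.
  rewrite exchange_big /=; apply: eq_bigr => t _.
  rewrite /diff_coef rmorph_sum mulr_suml /= big_mkcondr /=.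
  apply: eq_bigr => k _; case: ifP => // _.
  by rewrite rmorphM rmorphXn /= rmorphN1 sgn mul1r.
have: \sum_t (psi_chain w t)%:~R * F (res t) (lab t) = 1 :> bool.
  rewrite (bigD1 (psi_state w)) //= ffunE eqxx big1 => [|t /negbTE tp].
    by rewrite /res /lab /= Fpsi.
  by rewrite ffunE tp mul0r.
rewrite -dx.
under eq_bigr => t _ do rewrite ffunE rmorph_sum mulr_suml /=.
rewrite exchange_big big1 //= => s _.
under eq_bigr => t _ do rewrite rmorphM -mulrA.
by rewrite -mulr_sumr d0 mulr0.
Qed.

End Surgery.

Local Close Scope ring_scope.

(** * The five positive crossings closed by a turnback *)

Section Skeleton.
Local Open Scope nat_scope.
Implicit Types (r v b : seq bool) (i j p k : nat).

Definition pos_strand k := nth 0 [:: 1; 0; 0; 0; 1] k.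
Definition sw_idx k := 3 * k + pos_strand k.
Definition ne_idx k := 3 * k.+1 + (pos_strand k).+1.

(* The point 3 * l + s is strand s at level l of the positive part. The first
   three edges are the two sides of the turnback (its upper side is below the
   positive part, and its lower side is reached through the closure) and the
   third strand. *)
Definition edges r : seq (nat * nat) :=
  [:: (0, 1); (15, 16); (2, 17)] ++
  flatten [seq [seq (3 * k + s, 3 * k.+1 + s) | s <- iota 0 3 &
                   ~~ nth false r k || (s \notin [:: pos_strand k; (pos_strand k).+1])]
               ++ (if nth false r k then
                     [:: (sw_idx k, (sw_idx k).+1); ((ne_idx k).-1, ne_idx k)]
                   else [::])
          | k <- iota 0 5].

(** A naive union-find step on a table of representatives: the class with the larger representative
    takes over the smaller one. *)
Definition union (t : seq nat) (e : nat * nat) : seq nat :=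
  let x := nth 0 t e.1 in let y := nth 0 t e.2 in
  [seq if z == maxn x y then minn x y else z | z <- t].

Definition reps r : seq nat := foldl union (iota 0 18) (edges r).
Definition rep r i := nth 0 (reps r) i.

Definition relabel (g : nat -> bool) : seq bool := [seq g i | i <- iota 0 18].

(* A resolution of the positive crossings comes with the admissible sets of
   circles labelled v_+, each circle being given by one of its points. The first
   entry stands for psi, where there is no turnback: its circles are not those
   of [reps], which is harmless as none of them is labelled v_+. *)
Definition support : seq (seq bool * seq (seq nat)) :=
  let o := false in let l := true in
  [:: ([:: o; o; o; o; o], [:: [::]]);
      ([:: o; o; o; l; o], [:: [::]]);
      ([:: l; o; o; o; l], [:: [::]]);
      ([:: l; o; o; l; o], [:: [::]]);
      ([:: o; o; o; l; l], [:: [::]]);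
      ([:: l; o; l; l; o], [:: [:: 9]; [:: 12]]);
      ([:: o; o; l; l; l], [:: [:: 9]; [:: 12]]);
      ([:: o; l; l; l; o], [:: [:: 6; 9]; [:: 6; 12]; [:: 9; 12]]);
      ([:: l; l; l; l; o], [:: [:: 6; 9]; [:: 6; 12]; [:: 9; 12]]);
      ([:: o; l; l; l; l], [:: [:: 6; 9]; [:: 6; 12]; [:: 9; 12]]);
      ([:: l; l; l; l; l], [:: [:: 6; 9]; [:: 6; 12]; [:: 9; 12]])].

(** Labels are compared at all 18 points, so the circles outside the chosen set must carry v_-. *)
Definition phi r v : bool :=
  let R := nth 0 (reps r) in
  has (fun e => if e.1 == r then
    has (fun S => v == relabel (fun i => R i \in map R S)) e.2 else false) support.

(* [phi] after multiplication by v_- at the point p. *)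
Definition dot r v p : bool :=
  let R := nth 0 (reps r) in
  if nth false v p then phi r (relabel (fun i => (R i != R p) && nth false v i)) else false.

(* If no positive crossing is 1-resolved, there is a single turnback, and undoing
   it leads to the oriented resolution. *)
Definition twist_term r v : bool :=
  if r == nseq 5 false then phi r v else dot r v 0 (+) dot r v 15.

(** The skeleton counterpart of [split_flux] and [merge_flux]. *)
Definition pos_term r v k : bool :=
  let p := sw_idx k in let q := ne_idx k in let r' := set_nth false r k true in
  let R := nth 0 (reps r) in let R' := nth 0 (reps r') in
  if nth false r k then false else
  if R p == R q then
    if nth false v p then
      phi r' (relabel (fun i => (R' i != R' p) && nth false v i)) (+)
      phi r' (relabel (fun i => (R' i != R' q) && nth false v i))
    else phi r' v
  else if nth false v p || nth false v q then
    phi r' (relabel (fun i => if (R i == R p) || (R i == R q)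
      then nth false v p && nth false v q else nth false v i))
  else false.

Fixpoint bits n : seq (seq bool) :=
  if n is n'.+1 then [seq false :: b | b <- bits n'] ++ [seq true :: b | b <- bits n']
  else [:: [::]].

Lemma mem_bits b : b \in bits (size b).
Proof.
elim: b => //= x b IH; rewrite mem_cat.
by apply/orP; case: x; [right|left]; apply: map_f.
Qed.

(** One bit per circle, not per point: this enumerates exactly the labellings that are constant on
    circles. *)
Definition spread r b : seq bool :=
  let R := reps r in let U := undup R in
  relabel (fun i => nth false b (index (nth 0 R i) U)).

(** The cocycle condition: [phi] vanishes on the differential of every generator of degree -1 of the
    closed minimal model. *)
Lemma skeleton_cocycle_check : all (fun r => all (fun b =>
  let v := spread r b in
  ~~ foldr (fun k => addb (pos_term r v k)) (twist_term r v) (iota 0 5))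
   (bits (size (undup (reps r))))) (bits 5).
Proof. by vm_compute. Qed.

(** Replaces a completeness proof of the union-find pass: a table constant along all edges separates
    points only if they lie on different circles. *)
Lemma rep_edges_check : all (fun r => let R := nth 0 (reps r) in
  all (fun e => R e.1 == R e.2) (edges r)) (bits 5).
Proof. by vm_compute. Qed.

(** Each surgery is a merge or a split. This supplies the hypothesis on the resolution after the
    surgery in [merge_flux] and [split_flux]. *)
Lemma rep_surgery_check : all (fun r => all (fun k => nth false r k ||
  let p := sw_idx k in let q := ne_idx k in let r' := set_nth false r k true in
  (rep r p == rep r q) (+) (rep r' p == rep r' q)) (iota 0 5)) (bits 5).
Proof. by vm_compute. Qed.

Lemma rep_all_vertical : let r := nseq 5 false in
  rep r 15 = rep r 0 /\ rep r 1 = rep r 0.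
Proof. by split; vm_compute. Qed.

End Skeleton.

(** * The diagram of beta n *)

Lemma nth_relabel (g : nat -> bool) i : i < 18 -> nth false (relabel g) i = g i.
Proof. by move=> i18; rewrite (nth_map 0) ?size_iota // nth_iota. Qed.

Lemma eq_relabel (g h : nat -> bool) :
  (forall i, i < 18 -> g i = h i) -> relabel g = relabel h.
Proof. by move=> gh; apply/eq_in_map => i; rewrite mem_iota => /gh. Qed.

Lemma foldr_addb (S : Type) (h : S -> bool) z (l : seq S) :
  foldr (fun k => addb (h k)) z l = (z + \sum_(k <- l) h k)%R.
Proof.
elim: l => [|x l IH] /=; first by rewrite big_nil addr0.
by rewrite IH big_cons; exact: addbCA.
Qed.

Section ClosedBraid.
Variable n : nat.
Local Notation w := (beta n).
Local Notation N := (size w).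
Local Notation T := (2 * n + 3).
Implicit Types (a b : resolution w) (x y : point w) (k l i j : nat).
Implicit Types (f g : {ffun point w -> label}).

Lemma size_beta : N = T + 5.
Proof. by rewrite /beta size_cat size_nseq /=. Qed.

Definition strand k := if k < T then 0 else pos_strand (k - T).

Lemma strand_lt k : strand k < 2.
Proof.
rewrite /strand; case: ifP => // _; have : all (gtn 2) [:: 1; 0; 0; 0; 1] by [].
move/(all_nthP 0) => h; rewrite /pos_strand.
by case: (ltnP (k - T) 5) => [/h|h5] //; rewrite nth_default.
Qed.

Lemma crossingE (k : 'I_N) :
  (crossing k).1 = strand k :> nat /\ positive k = (T <= k).
Proof.
rewrite /positive /crossing (tnth_nth sigma2) /= /beta /strand nth_cat size_nseq.
have kN : k < T + 5 by rewrite -size_beta.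
case: ltnP => [kT|Tk].
  by rewrite nth_nseq kT.
have : k - T < 5 by lia.
by case: (k - T) => [|[|[|[|[|]]]]].
Qed.

Definition pt (s l : nat) : point w := (inord s, inord l).

Lemma pt_val x : pt x.1 x.2 = x.
Proof. by case: x => s l; rewrite /pt !inord_val. Qed.

Lemma ptE s l : s < 3 -> l <= N -> ((pt s l).1 = s :> nat) /\ ((pt s l).2 = l :> nat).
Proof. by move=> s3 lN; rewrite /pt !inordK. Qed.

Definition bit a k : bool := oapp a false (insub k).

Lemma bitE a (k : 'I_N) : bit a k = a k.
Proof. by rewrite /bit valK. Qed.

Lemma bit_flip a (k : 'I_N) j : bit (flip a k) j = (j == k) || bit a j.
Proof.
rewrite /bit; case: insubP => [i _ <-|/= jN]; first by rewrite /= ffunE.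
by case: eqP => // jk; rewrite jk ltn_ord in jN.
Qed.

Definition vertical a k := if k < T then bit a k else ~~ bit a k.

Lemma verticalE a (k : 'I_N) : vertical a k = braidlike a k.
Proof.
rewrite /vertical /braidlike (crossingE k).2 bitE leqNgt.
by case: ifP => _; case: (a k).
Qed.

Lemma corner_swE (k : 'I_N) : corner_sw k = pt (strand k) k.
Proof. by rewrite -[LHS]pt_val /= (crossingE k).1. Qed.

Lemma corner_seE (k : 'I_N) : corner_se k = pt (strand k).+1 k.
Proof. by rewrite -[LHS]pt_val /= /bump /= add1n (crossingE k).1. Qed.

Lemma corner_nwE (k : 'I_N) : corner_nw k = pt (strand k) k.+1.
Proof. by rewrite -[LHS]pt_val /= /bump /= add1n (crossingE k).1. Qed.

Lemma corner_neE (k : 'I_N) : corner_ne k = pt (strand k).+1 k.+1.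
Proof. by rewrite -[LHS]pt_val /= /bump /= !add1n (crossingE k).1. Qed.

Lemma arc_ind a (e : point w -> point w -> Prop) :
    (forall s, s < 3 -> e (pt s 0) (pt s N)) ->
    (forall k s, k < N -> s < 3 ->
       vertical a k || (s != strand k) && (s != (strand k).+1) ->
       e (pt s k) (pt s k.+1)) ->
    (forall k, k < N -> ~~ vertical a k ->
       e (pt (strand k) k) (pt (strand k).+1 k) /\
       e (pt (strand k) k.+1) (pt (strand k).+1 k.+1)) ->
  forall x y, arc a x y -> e x y.
Proof.
move=> eC eV eH x y /or3P[/and3P[/eqP h1 /eqP h2 /eqP h3]|/existsP[k]|/existsP[k]].
- rewrite -(pt_val x) -(pt_val y) h1 h2 h3; exact: eC.
- case/and4P => /eqP h1 /eqP h2 /eqP h3 h4.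
  rewrite -(pt_val x) -(pt_val y) h1 h2 h3 /= /bump /= add1n.
  apply: eV => //; rewrite verticalE; move: h4; rewrite h1 !inE negb_or.
  by rewrite -!val_eqE /= /bump /= add1n (crossingE k).1.
case/andP; rewrite -verticalE => /eH[]// e1 e2 /orP[] /andP[/eqP-> /eqP->].
  by rewrite corner_swE corner_seE.
by rewrite corner_nwE corner_neE.
Qed.

Lemma same_circle_closure a s : s < 3 -> same_circle a (pt s 0) (pt s N).
Proof.
move=> s3; apply: arc_same_circle; apply/or3P/Or31.
by rewrite eqxx -!val_eqE /= !inordK ?eqxx.
Qed.

Lemma same_circle_vert a k s : k < N -> s < 3 ->
    vertical a k || (s != strand k) && (s != (strand k).+1) ->
  same_circle a (pt s k) (pt s k.+1).
Proof.
move=> kN s3 h; apply: arc_same_circle; apply/or3P/Or32/existsP.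
pose K := Ordinal kN; have E := crossingE K.
exists K; rewrite !inE negb_or eqxx -!val_eqE /= !inordK ?ltnS ?(ltnW kN) // /bump /=.
by rewrite !add1n !eqxx E.1 -verticalE.
Qed.

Lemma same_circle_hor a k : k < N -> ~~ vertical a k ->
  same_circle a (pt (strand k) k) (pt (strand k).+1 k) /\
  same_circle a (pt (strand k) k.+1) (pt (strand k).+1 k.+1).
Proof.
move=> kN h; pose K := Ordinal kN.
rewrite -(corner_swE K) -(corner_seE K) -(corner_nwE K) -(corner_neE K).
split; apply: arc_same_circle; apply/or3P/Or33/existsP; exists K;
  by rewrite -verticalE h !eqxx ?orbT.
Qed.

Lemma same_circle_run a s i j : i <= j -> j <= N -> s < 3 ->
    (forall k, i <= k < j ->
       vertical a k || (s != strand k) && (s != (strand k).+1)) ->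
  same_circle a (pt s i) (pt s j).
Proof.
elim: j => [|j IH]; first by rewrite leqn0 => /eqP->; rewrite same_circle_refl.
rewrite leq_eqVlt => /orP[/eqP->|ij jN s3 h]; first by rewrite same_circle_refl.
apply: (same_circle_trans (IH _ _ _ _)) => //; try lia.
  by move=> k kj; apply: h; lia.
by apply: same_circle_vert => //; apply: h; lia.
Qed.

(** * Turnbacks and the small circles between them *)

Definition turnback a k := (k < T) && ~~ bit a k.

Lemma turnback_flip a (k : 'I_N) j : turnback (flip a k) j = (j != k) && turnback a j.
Proof. by rewrite /turnback bit_flip negb_or andbCA. Qed.

(* On the first two strands, level l belongs to a small circle. *)
Definition enclosed a l :=
  has (fun k => (k < l) && turnback a k) (iota 0 T) &&
  has (fun k => (l <= k) && turnback a k) (iota 0 T).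

Lemma has_turnbackP a (P : pred nat) :
  reflect (exists2 k, P k & turnback a k) (has (fun k => P k && turnback a k) (iota 0 T)).
Proof.
apply: (iffP hasP) => [[k _ /andP[]]|[k Pk zk]]; first by exists k.
by exists k; rewrite ?Pk // mem_iota; case/andP: zk.
Qed.

Lemma enclosedP a l :
  reflect (exists k1 k2, [/\ k1 < l <= k2, turnback a k1 & turnback a k2]) (enclosed a l).
Proof.
apply: (iffP andP) => [[/has_turnbackP[k1 h1 z1] /has_turnbackP[k2 h2 z2]]|].
  by exists k1, k2; rewrite h1 h2.
move=> [k1 [k2 [/andP[h1 h2] z1 z2]]].
by split; apply/has_turnbackP; [exists k1|exists k2].
Qed.

(** The turnback at [k] has its arcs at levels [k] and [k.+1], so the small circle between two
    consecutive turnbacks occupies the levels from [lo.+1] to [hi]. *)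
Definition gap a lo hi :=
  [/\ turnback a lo, turnback a hi, lo < hi & forall k, lo < k < hi -> ~~ turnback a k].

Lemma gapP a l : enclosed a l -> exists lo hi, gap a lo hi /\ lo < l <= hi.
Proof.
case/enclosedP => k1 [k2 [/andP[h1 h2] z1 z2]].
have e1 : exists k, (k < l) && turnback a k by exists k1; rewrite h1.
have e2 : exists k, (l <= k) && turnback a k by exists k2; rewrite h2.
have u1 k : (k < l) && turnback a k -> k <= l by lia.
case: (ex_maxnP e1 u1) => lo /andP[lol zlo] lomax.
case: (ex_minnP e2) => hi /andP[lhi zhi] himin.
exists lo, hi; split; last by rewrite lol.
split=> //; first lia.
move=> k kb; apply/negP => zk; have [kl|kl] := ltnP k l.
  by have := lomax k; rewrite kl zk => /(_ isT); lia.
by have := himin k; rewrite kl zk => /(_ isT); lia.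
Qed.

Lemma gap_vertical a lo hi k : gap a lo hi -> lo < k < hi -> vertical a k.
Proof.
move=> [_ /andP[hT _] _ h] kb; have := h _ kb.
have kT : k < T by lia.
by rewrite /turnback /vertical kT /= negbK.
Qed.

Lemma turnback_same_circle a k : turnback a k ->
  same_circle a (pt 0 k) (pt 1 k) /\ same_circle a (pt 0 k.+1) (pt 1 k.+1).
Proof.
case/andP => kT bk; have := @same_circle_hor a k.
rewrite /strand /vertical kT => H; apply: H => //; rewrite size_beta; lia.
Qed.

Lemma turnback_lt a k : turnback a k -> k < N.
Proof. by rewrite size_beta => /andP[]; lia. Qed.

Definition in_gap lo hi x := (x.1 < 2) && (lo < x.2 <= hi).

Lemma gap_connected a lo hi x y : gap a lo hi ->
  in_gap lo hi x -> in_gap lo hi y -> same_circle a x y.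
Proof.
move=> g; have hiN : hi < N by case: g => _ /turnback_lt.
have zhi : turnback a hi by case: g.
suff H z : in_gap lo hi z -> same_circle a z (pt 0 hi).
  by move=> /H h /H; rewrite same_circleC; apply: same_circle_trans.
case/andP => z1 /andP[z2 z3]; rewrite -(pt_val z).
apply: (@same_circle_trans _ _ _ (pt z.1 hi)).
  apply: same_circle_run; rewrite ?(ltnW hiN) //.
  by move=> k kb; rewrite (gap_vertical g) //; lia.
case: (val z.1) z1 => [_|[_|//]]; first exact: same_circle_refl.
by rewrite same_circleC (turnback_same_circle zhi).1.
Qed.

Lemma in_gap_pt lo hi s l : s < 3 -> l <= N ->
  in_gap lo hi (pt s l) = (s < 2) && (lo < l <= hi).
Proof. by move=> s3 lN; rewrite /in_gap (ptE s3 lN).1 (ptE s3 lN).2. Qed.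

(** Vertical edges are cut at both turnbacks and horizontal arcs stay at one level. Together with
    [gap_connected], the points of a gap form exactly one circle. *)
Lemma in_gap_inv a lo hi x y : gap a lo hi ->
  same_circle a x y -> in_gap lo hi x = in_gap lo hi y.
Proof.
move=> g; have [zlo zhi lohi _] := g; apply: same_circle_inv.
have hT : hi < T by case/andP: zhi.
apply: arc_ind => [s s3|k s kN s3|k kN vk].
- by rewrite !in_gap_pt // size_beta; lia.
- rewrite !in_gap_pt ?(ltnW kN) //.
  have [->|] := eqVneq k lo; [|have [->|] := eqVneq k hi].
  + move: zlo; rewrite /turnback /vertical /strand; case: ltnP => //= _ /negbTE->; lia.
  + move: zhi; rewrite /turnback /vertical /strand; case: ltnP => //= _ /negbTE->; lia.
  + lia.
have s2 := strand_lt k; rewrite !in_gap_pt ?(ltnW kN) ?ltnS //; try lia.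
rewrite /strand; case: ifP => kT; lia.
Qed.

(** * Comparison with the 18-point skeleton *)

Definition posbits a : seq bool := [seq bit a (T + k) | k <- iota 0 5].

Definition opt i : point w := pt (i %% 3) (T + i %/ 3).

Lemma size_posbits a : size (posbits a) = 5. Proof. by []. Qed.

Lemma posbits_in a : posbits a \in bits 5.
Proof. exact: (mem_bits (posbits a)). Qed.

Lemma nth_posbits a k : k < 5 -> nth false (posbits a) k = bit a (T + k).
Proof. by move=> k5; rewrite (nth_map 0) ?size_iota // nth_iota. Qed.

Lemma all_mem (S : eqType) (s : seq S) (P : pred S) (x : S) : all P s -> x \in s -> P x.
Proof. by move/allP; apply. Qed.

Lemma rep_edge a e : e \in edges (posbits a) ->
  rep (posbits a) e.1 = rep (posbits a) e.2.
Proof. by move=> ee; apply/eqP/(all_mem (all_mem rep_edges_check (posbits_in a)) ee). Qed.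

Lemma opt_pt s k : s < 3 -> opt (3 * k + s) = pt s (T + k).
Proof. by move=> s3; rewrite /opt; congr pt; lia. Qed.

Lemma strand_pos k : strand (T + k) = pos_strand k.
Proof. by rewrite /strand ltnNge leq_addr addKn. Qed.

Lemma vertical_pos a k : vertical a (T + k) = ~~ bit a (T + k).
Proof. by rewrite /vertical ltnNge leq_addr. Qed.

Lemma edge_vert a k s : k < 5 -> s < 3 ->
    vertical a (T + k) || (s != strand (T + k)) && (s != (strand (T + k)).+1) ->
  (3 * k + s, 3 * k.+1 + s) \in edges (posbits a).
Proof.
move=> k5 s3; rewrite strand_pos vertical_pos => h.
rewrite mem_cat; apply/orP; right; apply/flatten_mapP; exists k.
  by rewrite mem_iota.
rewrite mem_cat; apply/orP; left; apply/mapP; exists s => //.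
by rewrite mem_filter mem_iota nth_posbits // !inE negb_or h.
Qed.

Lemma edge_hor a k : k < 5 -> ~~ vertical a (T + k) ->
  (sw_idx k, (sw_idx k).+1) \in edges (posbits a) /\
  ((ne_idx k).-1, ne_idx k) \in edges (posbits a).
Proof.
move=> k5; rewrite vertical_pos negbK => h.
have H e : e \in [:: (sw_idx k, (sw_idx k).+1); ((ne_idx k).-1, ne_idx k)] ->
    e \in edges (posbits a).
  move=> he; rewrite mem_cat; apply/orP; right; apply/flatten_mapP; exists k.
    by rewrite mem_iota.
  by rewrite mem_cat nth_posbits // h he orbT.
by split; apply: H; rewrite !inE eqxx ?orbT.
Qed.

(** Follows the strand from [x] to a skeleton point: up to level T if no turnback is in the way,
    otherwise down to level 0 and through the closure to the last level, whence 15. The values on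
    small circles are overridden in [circle_code]. *)
Definition ridx a x : nat :=
  if T <= x.2 then 3 * (x.2 - T) + x.1 else
  if x.1 == 2 :> nat then 2 else
  if has (fun k => (x.2 <= k) && turnback a k) (iota 0 T) then 15 + x.1 else x.1.

(* The code 18 is shared by all the small circles. *)
Definition circle_code a x : nat :=
  if (x.1 < 2) && enclosed a x.2 then 18 else rep (posbits a) (ridx a x).

Lemma enclosed_lt a l : enclosed a l -> l < T.
Proof. by case/enclosedP => k1 [k2 [h1 _ /andP[]]]; lia. Qed.

Lemma ridx_low a s l : s < 3 -> l <= T -> s != 2 ->
  ridx a (pt s l) =
  if has (fun k => (l <= k) && turnback a k) (iota 0 T) then 15 + s else s.
Proof.
move=> s3 lT s2; have lN : l <= N by rewrite size_beta; lia.
rewrite /ridx (ptE s3 lN).1 (ptE s3 lN).2 (negbTE s2).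
have [Tl|//] := leqP T l; have -> : l = T by lia.
rewrite subnn; case: has_turnbackP => // [[k h /andP[]]]; lia.
Qed.

Lemma ridx_high a s k : s < 3 -> k <= 5 -> ridx a (pt s (T + k)) = 3 * k + s.
Proof.
move=> s3 k5; have lN : T + k <= N by rewrite size_beta; lia.
by rewrite /ridx (ptE s3 lN).1 (ptE s3 lN).2 leq_addr addKn.
Qed.

Lemma ridx2 a l : l <= T -> ridx a (pt 2 l) = 2.
Proof.
move=> lT; have lN : l <= N by rewrite size_beta; lia.
have p := @ptE 2 l isT lN; rewrite /ridx p.1 p.2.
case: leqP => // Tl; lia.
Qed.

Lemma circle_codeE a s l : s < 3 -> l <= N -> circle_code a (pt s l) =
  if (s < 2) && enclosed a l then 18 else rep (posbits a) (ridx a (pt s l)).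
Proof. by move=> s3 lN; rewrite /circle_code (ptE s3 lN).1 (ptE s3 lN).2. Qed.

Lemma enclosed_S a k : ~~ turnback a k -> enclosed a k.+1 = enclosed a k.
Proof.
move=> zk; have nk j : turnback a j -> k != j by move=> zj; apply: contraNneq zk => ->.
by apply/enclosedP/enclosedP => -[k1 [k2 [h /[dup] z1 /nk n1 /[dup] z2 /nk n2]]];
  exists k1, k2; split=> //; lia.
Qed.

Lemma has_above_S a k : ~~ turnback a k ->
  has (fun j => (k.+1 <= j) && turnback a j) (iota 0 T) =
  has (fun j => (k <= j) && turnback a j) (iota 0 T).
Proof.
move=> zk; apply/has_turnbackP/has_turnbackP => -[j h z]; exists j => //; first lia.
by have : k != j; [apply: contraNneq zk => -> | lia].
Qed.

Lemma circle_code_inv a k0 x y : turnback a k0 ->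
  same_circle a x y -> circle_code a x = circle_code a y.
Proof.
move=> z0; apply: same_circle_inv; have z0T : k0 < T by case/andP: z0.
have enclF l : T <= l -> enclosed a l = false.
  by move=> Tl; apply/negP => /enclosed_lt; lia.
have low k : k < T -> k <= N /\ k.+1 <= N by rewrite size_beta; lia.
apply: arc_ind => [s s3|k s kN s3|k kN].
- rewrite !circle_codeE // (enclF N); last by rewrite size_beta; lia.
  have -> : enclosed a 0 = false by apply/negP => /enclosedP[? [? []]].
  rewrite !andbF size_beta ridx_high //.
  have [->|s2] := eqVneq s 2; first by rewrite ridx2 // (@rep_edge a (2, 17)).
  (* A turnback above level 0 gives the strand there the index of the other end of its closure
     arc. *)
  rewrite ridx_low //; case: has_turnbackP => // -[]; by exists k0.
- rewrite !circle_codeE // ?(ltnW kN) //; have [kT|Tk] := ltnP k T.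
    have [->|s2] := eqVneq s 2; first by rewrite /= !ridx2 // ltnW.
    rewrite !ridx_low // ?(ltnW kT) // /vertical /strand kT.
    have -> : ((s != 0) && (s != 1)) = false by lia.
    rewrite orbF => bk; have zk : ~~ turnback a k by rewrite /turnback bk andbF.
    by rewrite enclosed_S // has_above_S.
  rewrite !enclF ?andbF; [|lia..]; move=> h.
  have [j j5 kj] : exists2 j, j < 5 & k = T + j.
    by exists (k - T); move: kN; rewrite size_beta; lia.
  rewrite kj in h *; rewrite -addnS !ridx_high //; last by lia.
  exact: rep_edge (edge_vert j5 s3 h).
have [kT|Tk] := ltnP k T; last first.
  move=> vk; have [j j5 kj] : exists2 j, j < 5 & k = T + j.
    by exists (k - T); move: kN; rewrite size_beta; lia.
  have := strand_lt k; rewrite kj in vk * => s2.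
  rewrite !circle_codeE ?enclF //; try by rewrite ?size_beta; lia.
  rewrite !andbF -addnS !ridx_high //; try lia.
  have [/rep_edge e1 /rep_edge e2] := edge_hor j5 vk.
  rewrite strand_pos; split; [move: e1|move: e2]; rewrite /= /sw_idx /ne_idx ?addnS //=.
rewrite /vertical /strand kT => bk; have zk : turnback a k by rewrite /turnback kT.
have [kN' kN2] := low _ kT.
rewrite !circle_codeE // !ridx_low ?(ltnW kT) //=.
have -> : has (fun j => (k <= j) && turnback a j) (iota 0 T).
  by apply/has_turnbackP; exists k.
(* Off the small circles, the lower arc is the edge (15, 16). The upper arc lies on a small circle
   if another turnback is above it, and is the edge (0, 1) otherwise. *)
split; first by case: ifP => // _; rewrite (@rep_edge a (15, 16)).
case eS: (enclosed a k.+1) => //; case: has_turnbackP => [[j kj zj]|_].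
  by case/negP: (negbT eS); apply/enclosedP; exists k, j; split=> //; lia.
by rewrite (@rep_edge a (0, 1)).
Qed.

(** The edge (0, 1) is realised by the highest turnback, (15, 16) by the lowest one through the
    closure, and (2, 17) by the third strand. *)
Lemma edge_sound a k0 e : turnback a k0 -> e \in edges (posbits a) ->
  [/\ e.1 < 18, e.2 < 18 & same_circle a (opt e.1) (opt e.2)].
Proof.
move=> z0; have z0T : k0 < T by case/andP: z0.
rewrite mem_cat => /orP[|/flatten_mapP[k]].
  rewrite !inE => /or3P[] /eqP->; split=> //.
  - have u k : turnback a k -> k <= T by case/andP; lia.
    case: (ex_maxnP (ex_intro _ k0 z0) u) => M zM maxM.
    have MT : M < T by case/andP: zM.
    have r s : s < 2 -> same_circle a (pt s M.+1) (pt s T).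
      move=> s2; apply: same_circle_run; rewrite ?size_beta; try lia.
      move=> k kb; rewrite /vertical; have -> : k < T by lia.
      have : ~~ turnback a k by apply/negP => /maxM; lia.
      by rewrite /turnback; have -> : k < T by [lia]; rewrite negbK => ->.
    rewrite /= (@opt_pt 0 0) // (@opt_pt 1 0) // addn0.
    apply: same_circle_trans (r 1 isT); apply: same_circle_trans (turnback_same_circle zM).2.
    by rewrite same_circleC; apply: r.
  - case: (ex_minnP (ex_intro _ k0 z0)) => M zM minM.
    have MT : M < T by case/andP: zM.
    have r s : s < 2 -> same_circle a (pt s 0) (pt s M).
      move=> s2; apply: same_circle_run; rewrite ?size_beta; try lia.
      move=> k kb; rewrite /vertical; have -> : k < T by lia.
      have : ~~ turnback a k by apply/negP => /minM; lia.
      by rewrite /turnback; have -> : k < T by [lia]; rewrite negbK => ->.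
    rewrite /= (@opt_pt 0 5) // (@opt_pt 1 5) // -size_beta.
    apply: same_circle_trans (same_circle_closure a (isT : 1 < 3)).
    rewrite same_circleC; apply: same_circle_trans (same_circle_closure a (isT : 0 < 3)).
    rewrite same_circleC; apply: (same_circle_trans (r 0 isT)).
    by apply: (same_circle_trans (turnback_same_circle zM).1); rewrite same_circleC r.
  - rewrite /= (@opt_pt 2 0) // (@opt_pt 2 5) // -size_beta.
    apply: same_circle_trans (same_circle_closure a (isT : 2 < 3)).
    rewrite same_circleC addn0; apply: same_circle_run; rewrite ?size_beta; try lia.
    by move=> k /andP[_ kT]; rewrite /strand kT orbT.
rewrite mem_iota leq0n add0n andTb => k5; rewrite mem_cat => /orP[/mapP[s]|].
  rewrite mem_filter mem_iota nth_posbits // !inE negb_or => /andP[h s3] ->.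
  have kN : T + k < N by rewrite size_beta; lia.
  split; try by rewrite /=; lia.
  rewrite !opt_pt // (addnS T k); apply: same_circle_vert => //.
  by rewrite vertical_pos strand_pos.
rewrite nth_posbits //; case: ifP => // bk.
have kN : T + k < N by rewrite size_beta; lia.
have s2 : pos_strand k < 2 by have := strand_lt (T + k); rewrite strand_pos.
have := @same_circle_hor a (T + k) kN.
rewrite vertical_pos strand_pos bk => /(_ isT) [h1 h2].
rewrite !inE /sw_idx /ne_idx => /orP[] /eqP->; split=> [||]; try by rewrite /=; lia.
  by rewrite /= -addnS !opt_pt //; lia.
rewrite /fst /snd (_ : (_ + _).-1 = 3 * k.+1 + pos_strand k); last by lia.
by rewrite !opt_pt ?(addnS T k) //; lia.
Qed.

(** An invariant of the union-find pass: every entry of the table names a point on the same circle,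
    because each step joins along a realised edge. *)
Lemma rep_sound a k0 i : turnback a k0 -> i < 18 ->
  rep (posbits a) i < 18 /\ same_circle a (opt i) (opt (rep (posbits a) i)).
Proof.
move=> z0; rewrite /rep /reps.
have eS : {in edges (posbits a), forall e,
    [/\ e.1 < 18, e.2 < 18 & same_circle a (opt e.1) (opt e.2)]}.
  by move=> e; apply: edge_sound z0.
pose ok (t : seq nat) := size t = 18 /\
  forall j, j < 18 -> nth 0 t j < 18 /\ same_circle a (opt j) (opt (nth 0 t j)).
suff H t es : ok t -> {subset es <= edges (posbits a)} -> ok (foldl union t es).
  have [] := H (iota 0 18) (edges (posbits a)).
  - split; first by rewrite size_iota.
    by move=> j j18; rewrite nth_iota // same_circle_refl.
  - by [].
  - by move=> _; apply.
elim: es t => //= e es IH t [st tP] sub; apply: IH; last first.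
  by move=> x xs; apply: sub; rewrite inE xs orbT.
have [e1 e2 e12] := eS e (sub e (mem_head _ _)).
rewrite /union; set x := nth 0 t e.1; set y := nth 0 t e.2.
have [x18 xP] := tP _ e1; have [y18 yP] := tP _ e2.
have xy : same_circle a (opt x) (opt y).
  apply: same_circle_trans yP; apply: same_circle_trans e12.
  by rewrite same_circleC.
have yx := xy; rewrite same_circleC in yx.
split=> [|j j18]; first by rewrite size_map.
rewrite (nth_map 0) ?st //; have [z18 zP] := tP _ j18.
case: eqP => // zE; split; first by rewrite /minn; case: ifP.
apply: (same_circle_trans zP); rewrite zE /maxn /minn; case: ifP => //.
Qed.

Lemma opt_enclosed i s l a : s < 2 -> enclosed a l -> i < 18 ->
  same_circle a (opt i) (pt s l) = false.
Proof.
move=> s2 el i18; apply/negP => h; have /enclosedP[k1 [k2 [_ z1 _]]] := el.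
have := circle_code_inv z1 h.
have lT := enclosed_lt el.
have iN : T + i %/ 3 <= N by rewrite size_beta; lia.
have i3 : i %% 3 < 3 by rewrite ltn_mod.
have -> : circle_code a (opt i) = rep (posbits a) i.
  rewrite circle_codeE // ridx_high //; last by lia.
  have -> : enclosed a (T + i %/ 3) = false by apply/negP => /enclosed_lt; lia.
  by rewrite andbF; congr rep; lia.
rewrite circle_codeE; [|lia|rewrite size_beta; lia].
rewrite s2 el /=; have := (rep_sound z1 i18).1; lia.
Qed.

(** One direction is [rep_sound]; for the other, [circle_code] is constant on circles and agrees
    with [rep] on the positive part. *)
Lemma same_circle_opt a k0 i j : turnback a k0 -> i < 18 -> j < 18 ->
  same_circle a (opt i) (opt j) = (rep (posbits a) i == rep (posbits a) j).
Proof.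
move=> z0 i18 j18.
have cE l : l < 18 -> circle_code a (opt l) = rep (posbits a) l.
  move=> l18; have l3 : l %% 3 < 3 by rewrite ltn_mod.
  have lN : T + l %/ 3 <= N by rewrite size_beta; lia.
  rewrite circle_codeE // ridx_high //; last by lia.
  have -> : enclosed a (T + l %/ 3) = false by apply/negP => /enclosed_lt; lia.
  by rewrite andbF; congr rep; lia.
apply/idP/eqP => [/(circle_code_inv z0)|e]; first by rewrite !cE.
apply: (same_circle_trans (rep_sound z0 i18).2); rewrite e same_circleC.
exact: (rep_sound z0 j18).2.
Qed.

(** * The functional *)

Implicit Types (s t : state w).

Definition turnbacks a := count (turnback a) (iota 0 T).
Definition vlab f := relabel (fun i => f (opt i)).
(** The counit on all small circles. Strand 0 suffices, since strand 1 at an enclosed level is on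
    the same circle. *)
Definition small a f := all (fun l => enclosed a l ==> ~~ f (pt 0 l)) (iota 0 T).
Definition functional a f :=
  [&& turnbacks a == count id (posbits a), small a f & phi (posbits a) (vlab f)].

(* What the crossing k contributes to the functional of the differential of s;
   signs disappear mod 2. *)
Local Notation flux k s := (\sum_(t | res t == flip (res s) k)
  ((surgery_coef k s t)%:~R * functional (res t) (lab t)))%R.

Lemma smallP a f : reflect (forall l, enclosed a l -> f (pt 0 l) = false) (small a f).
Proof.
apply: (iffP allP) => [h l el|h l _].
  by apply/negbTE; apply: (implyP (h l _)) => //; rewrite mem_iota (enclosed_lt el).
by apply/implyP => /h ->.
Qed.

Lemma mem_turnbacks a i : (i \in filter (turnback a) (iota 0 T)) = turnback a i.
Proof. by rewrite mem_filter mem_iota /turnback; case: (i < T); rewrite ?andbF ?andbT. Qed.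

Lemma turnbacks_flip_twist a (k : 'I_N) : turnback a k -> (turnbacks (flip a k)).+1 = turnbacks a.
Proof.
move=> zk; rewrite /turnbacks -[RHS]size_filter -(count_predC (pred1 (k : nat))).
rewrite count_uniq_mem ?filter_uniq ?iota_uniq // mem_turnbacks zk add1n count_filter.
by congr _.+1; apply: eq_count => j; rewrite turnback_flip.
Qed.

Lemma turnbacks_flip_pos a (k : 'I_N) : T <= k -> turnbacks (flip a k) = turnbacks a.
Proof.
move=> Tk; apply: eq_in_count => j; rewrite mem_iota turnback_flip => jT.
by have -> : j != k by lia.
Qed.

Lemma turnback_other a i : 1 < turnbacks a -> exists2 j, j != i & turnback a j.
Proof.
rewrite /turnbacks -size_filter => h.
have [/allP all_i|/allPn[j]] := boolP (all (pred1 i) (filter (turnback a) (iota 0 T))).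
  have := @uniq_leq_size _ (filter (turnback a) (iota 0 T)) [:: i].
  rewrite filter_uniq ?iota_uniq // => /(_ isT) H.
  have : size (filter (turnback a) (iota 0 T)) <= 1.
    by apply: H => j /all_i /eqP->; rewrite mem_head.
  by lia.
by rewrite mem_turnbacks => zj ji; exists j.
Qed.

Lemma turnback_unique a i j : turnbacks a <= 1 -> turnback a i -> turnback a j -> i = j.
Proof.
rewrite /turnbacks -size_filter => h zi zj; apply/eqP/negPn/negP => ij.
have := @uniq_leq_size _ [:: i; j] (filter (turnback a) (iota 0 T)).
rewrite /= inE ij => /(_ isT) H.
suff : 2 <= size (filter (turnback a) (iota 0 T)) by lia.
by apply: H => k; rewrite !inE => /orP[] /eqP->; rewrite mem_turnbacks.
Qed.

Lemma posbits_flip_twist a (k : 'I_N) : k < T -> posbits (flip a k) = posbits a.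
Proof.
move=> kT; apply/eq_in_map => j; rewrite mem_iota bit_flip => _.
by have -> : (T + j == k) = false by lia.
Qed.

Lemma posbits_flip_pos a (k : 'I_N) j : j < 5 -> k = T + j :> nat ->
  posbits (flip a k) = set_nth false (posbits a) j true.
Proof.
move=> j5 kj; apply: (@eq_from_nth _ false).
  by rewrite size_set_nth !size_posbits; lia.
move=> i; rewrite size_posbits => i5; rewrite nth_set_nth /= !nth_posbits // bit_flip kj.
by rewrite eqn_add2l; case: (i == j).
Qed.

Lemma count_set_nth (r : seq bool) j : j < size r -> nth false r j = false ->
  count id (set_nth false r j true) = (count id r).+1.
Proof.
elim: r j => // x r IH [|j] /=; first by move=> _ ->.
by move=> jr rj; rewrite IH ?addnS.
Qed.

(** Undoing a turnback and 1-resolving a positive crossing both raise the homological degree by one,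
    so only degree -1 reaches degree 0. *)
Lemma functional_count0 (k : 'I_N) s : ~~ res s k ->
    turnbacks (res s) != (count id (posbits (res s))).+1 ->
  flux k s = 0%R.
Proof.
move=> sk hc; apply: big1 => t /eqP->; rewrite /functional.
suff /negbTE-> : turnbacks (flip (res s) k) != count id (posbits (flip (res s) k)).
  by rewrite mulr0.
have [kT|Tk] := ltnP k T.
  rewrite posbits_flip_twist //; apply: contra hc => /eqP <-.
  by rewrite turnbacks_flip_twist // /turnback kT bitE.
have [j j5 kj] : exists2 j, j < 5 & k = T + j :> nat.
  by exists (k - T); [have : k < T + 5 by [rewrite -size_beta]|]; lia.
rewrite (posbits_flip_pos _ j5 kj) turnbacks_flip_pos //.
by rewrite count_set_nth ?size_posbits // nth_posbits // -kj bitE (negbTE sk).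
Qed.

Lemma enclosed_flip_pos a (k : 'I_N) l : T <= k -> enclosed (flip a k) l = enclosed a l.
Proof.
move=> Tk; apply/enclosedP/enclosedP => -[k1 [k2 [h z1 z2]]]; exists k1, k2; split=> //.
- by move: z1; rewrite turnback_flip => /andP[].
- by move: z2; rewrite turnback_flip => /andP[].
- by rewrite turnback_flip z1 andbT; case/andP: z1; lia.
- by rewrite turnback_flip z2 andbT; case/andP: z2; lia.
Qed.

Lemma idx_bounds j : j < 5 -> sw_idx j < 18 /\ ne_idx j < 18.
Proof.
move=> j5; have := strand_lt (T + j); rewrite strand_pos /sw_idx /ne_idx; lia.
Qed.

(** No corner of a positive crossing lies on a small circle: the counit factor is untouched and the
    surgery happens inside the skeleton. *)
Lemma flux_pos (k : 'I_N) s j k0 : j < 5 -> k = T + j :> nat -> ~~ res s k ->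
    turnback (res s) k0 -> turnbacks (res s) = (count id (posbits (res s))).+1 ->
  flux k s = small (res s) (lab s) && pos_term (posbits (res s)) (vlab (lab s)) j.
Proof.
move=> j5 kj sk z0 hc; set a := res s; set f := lab s; set r := posbits a.
have Tk : T <= k by rewrite kj leq_addr.
have [p18 q18] := idx_bounds j5.
have pE : corner_sw k = opt (sw_idx j).
  by rewrite corner_swE kj strand_pos opt_pt //; have := strand_lt (T + j); rewrite strand_pos; lia.
have qE : corner_ne k = opt (ne_idx j).
  by rewrite corner_neE kj strand_pos opt_pt ?addnS //; have := strand_lt (T + j); rewrite strand_pos; lia.
have rj : nth false r j = false by rewrite nth_posbits // -kj bitE (negbTE sk).
have bE : posbits (flip a k) = set_nth false r j true by rewrite (posbits_flip_pos _ j5 kj).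
have zb : turnback (flip a k) k0.
  by rewrite turnback_flip z0 andbT; case/andP: z0; lia.
have FE g : (forall l, enclosed a l -> g (pt 0 l) = f (pt 0 l)) ->
    functional (flip a k) g = small a f && phi (set_nth false r j true) (vlab g).
  move=> gf; rewrite /functional turnbacks_flip_pos // bE count_set_nth ?size_posbits //.
  rewrite hc eqxx /=; congr (_ && _).
  apply/smallP/smallP => h l el; first by rewrite -gf // h // enclosed_flip_pos.
  by rewrite enclosed_flip_pos // in el; rewrite gf // h.
have := all_mem (all_mem rep_surgery_check (posbits_in a)) (_ : j \in iota 0 5).
rewrite mem_iota -/r rj /= => /(_ j5) chk.
rewrite /pos_term rj; lazy zeta.
have ee l i : enclosed a l -> i < 18 -> same_circle a (pt 0 l) (opt i) = false.
  by move=> el i18; rewrite same_circleC (opt_enclosed _ el).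
have eb l i : enclosed a l -> i < 18 -> same_circle (flip a k) (pt 0 l) (opt i) = false.
  by move=> el i18; rewrite same_circleC (opt_enclosed _ (l := l)) // enclosed_flip_pos.
have [e|e] := eqVneq (rep r (sw_idx j)) (rep r (ne_idx j)).
  rewrite split_flux pE qE; last first.
  - rewrite (same_circle_opt zb) // bE; move: chk; rewrite e eqxx; by case: eqP.
  - by rewrite (same_circle_opt z0) // -/r e.
  rewrite /vlab nth_relabel // -/f -/a.
  have mE i : i < 18 -> vlab (set_minus (flip a k) f (opt i)) =
      relabel (fun l => (rep (set_nth false r j true) l != rep (set_nth false r j true) i) &&
        nth false (relabel (fun i => f (opt i))) l).
    move=> i18; apply: eq_relabel => l l18.
    by rewrite ffunE (same_circle_opt zb) // bE nth_relabel.
  case: ifP => _; last by rewrite FE.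
  rewrite !FE; first by rewrite !mE //; case: (small a f).
  - by move=> l el; rewrite ffunE eb.
  - by move=> l el; rewrite ffunE eb.
rewrite merge_flux pE qE; last first.
- rewrite (same_circle_opt zb) // bE; move: chk; rewrite (negbTE e); by case: eqP.
- by rewrite (same_circle_opt z0) // -/r.
rewrite -/a -/f /vlab !nth_relabel //; case: ifP => _; last by rewrite andbF.
rewrite FE => [|l el]; last by rewrite ffunE pE qE !ee.
congr (_ && phi _ _); apply: eq_relabel => i i18.
by rewrite ffunE pE qE !(same_circle_opt z0) // nth_relabel.
Qed.

(** * Undoing a turnback *)

Lemma corners_twist a (k : 'I_N) : turnback a k ->
  corner_sw k = pt 0 k /\ corner_ne k = pt 1 k.+1.
Proof. by case/andP => kT _; rewrite corner_swE corner_neE /strand kT. Qed.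

Lemma vertical_flip a (k : 'I_N) : turnback a k -> vertical (flip a k) k.
Proof. by case/andP => kT _; rewrite /vertical kT bit_flip eqxx. Qed.

Lemma vertical_flip_gap a (k : 'I_N) lo hi j : gap a lo hi -> lo < j < hi ->
  vertical (flip a k) j.
Proof.
move=> g jb; have := gap_vertical g jb; have [_ /andP[hT _] _ _] := g.
by rewrite /vertical bit_flip; have -> : j < T; [lia | move=> ->; rewrite orbT].
Qed.

Lemma gap_sep a lo hi l i : gap a lo hi -> lo < l <= hi -> turnback a i ->
  (i < l -> i <= lo) /\ (l <= i -> hi <= i).
Proof.
move=> [_ _ _ h] lb zi; split=> il; rewrite leqNgt; apply/negP => ?;
  by (have /h : lo < i < hi by lia); rewrite zi.
Qed.

Lemma gap_succ a k j : turnback a k -> turnback a j -> k < j -> exists hi, gap a k hi.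
Proof.
move=> zk zj kj; have e : enclosed a k.+1 by apply/enclosedP; exists k, j; split=> //; lia.
have [lo [hi [g h]]] := gapP e.
have [/(_ (ltnSn k)) klo _] := gap_sep g h zk.
by exists hi; have -> : k = lo by lia.
Qed.

Lemma gap_pred a k j : turnback a k -> turnback a j -> j < k -> exists lo, gap a lo k.
Proof.
move=> zk zj kj; have e : enclosed a k by apply/enclosedP; exists j, k; split=> //; lia.
have [lo [hi [g h]]] := gapP e.
have [_ /(_ (leqnn k)) klo] := gap_sep g h zk.
by exists lo; have -> : k = hi by lia.
Qed.

Lemma below_same_circle a k : turnback a k -> (forall j, turnback a j -> k <= j) ->
  same_circle a (pt 0 k) (opt 15).
Proof.
move=> zk kmin; have kT : k < T by case/andP: zk.
have -> : opt 15 = pt 0 N by rewrite (@opt_pt 0 5) // size_beta.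
apply: same_circle_trans (same_circle_closure _ (isT : 0 < 3)).
rewrite same_circleC; apply: same_circle_run; rewrite ?size_beta; try lia.
move=> j jk; have jT : j < T by lia.
have : ~~ turnback a j by apply/negP => /kmin; lia.
by rewrite /turnback /vertical jT negbK => ->.
Qed.

Lemma above_same_circle a k : turnback a k -> (forall j, turnback a j -> j <= k) ->
  same_circle a (pt 1 k.+1) (opt 0).
Proof.
move=> zk kmax; have kT : k < T by case/andP: zk.
have -> : opt 0 = pt 0 T by rewrite (@opt_pt 0 0) // addn0.
rewrite same_circleC; apply: same_circle_trans (turnback_same_circle zk).2.
rewrite same_circleC; apply: same_circle_run; rewrite ?size_beta; try lia.
move=> j jk; have jT : j < T by lia.
have : ~~ turnback a j by apply/negP => /kmax; lia.
by rewrite /turnback /vertical jT negbK => ->.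
Qed.

Lemma count_id0 (r : seq bool) : count id r = 0 -> r = nseq (size r) false.
Proof. by elim: r => // -[] //= r IH; rewrite add0n => /IH {1}->. Qed.

Lemma phi0 v : phi (nseq 5 false) v = (v == relabel (fun=> false)).
Proof. by rewrite /phi /= !orbF. Qed.

Lemma phi0P f : phi (nseq 5 false) (vlab f) -> forall i, i < 18 -> f (opt i) = false.
Proof.
rewrite phi0 => /eqP h i i18.
by have := congr1 (fun v => nth false v i) h; rewrite /vlab !nth_relabel.
Qed.

(** The saddle of the minimal model. Its two corners share a circle through the closure, so it is a
    split, and the result has the three strands as circles. A v_+ on the split circle would survive
    on one strand, where psi has only v_-. *)
Lemma flux_twist_single (k : 'I_N) s : turnback (res s) k -> turnbacks (res s) = 1 ->
    count id (posbits (res s)) = 0 ->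
  flux k s = small (res s) (lab s) && phi (posbits (res s)) (vlab (lab s)).
Proof.
set a := res s; set f := lab s => zk z1 /count_id0 r0; rewrite size_posbits in r0.
have zu j : turnback a j -> j = k by move=> zj; apply: (turnback_unique _ zj zk); rewrite z1.
have kT : k < T by case/andP: zk.
set b := flip a k.
have rb : posbits b = nseq 5 false by rewrite posbits_flip_twist.
have zb : turnbacks b = 0 by apply: succn_inj; rewrite turnbacks_flip_twist.
have bE : b = oriented_resolution w.
  apply/ffunP => j; rewrite -(bitE b) [RHS]ffunE (crossingE j).2 -ltnNge.
  have [jT|Tj] := ltnP j T.
    rewrite bit_flip; case: eqP => //= jk; apply/negPn/negP => bj.
    by apply: jk; apply: zu; rewrite /turnback jT.
  have jN : j < T + 5 by rewrite -size_beta.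
  have -> : j = T + (j - T) :> nat by lia.
  rewrite -nth_posbits ?rb ?nth_nseq ?if_same //; lia.
have FE g : functional b g = phi (nseq 5 false) (vlab g).
  rewrite /functional zb rb /=; case: smallP => // -[] l /enclosedP[k1 [k2 [h]]].
  by rewrite !turnback_flip => /andP[/eqP n1 /zu] e1.
have -> : small a f.
  apply/smallP => l /enclosedP[k1 [k2 [h /zu e1 /zu e2]]]; lia.
have [pE qE] := corners_twist zk.
have p15 : same_circle a (corner_sw k) (opt 15).
  by rewrite pE; apply: below_same_circle => // j /zu->.
have q0 : same_circle a (corner_ne k) (opt 0).
  by rewrite qE; apply: above_same_circle => // j /zu->.
have pq : same_circle a (corner_sw k) (corner_ne k).
  apply: (same_circle_trans p15); rewrite same_circleC; apply: (same_circle_trans q0).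
  by rewrite (same_circle_opt zk) // r0 rep_all_vertical.1.
have cross i j l l' : i < 3 -> j < 3 -> i != j ->
    same_circle b (pt i l) (pt j l') = false.
  move=> i3 j3 ij; apply/negP; rewrite bE => /same_circle_oriented /(congr1 val).
  by rewrite /= !inordK // => e; rewrite e eqxx in ij.
rewrite split_flux -/a -/f -/b //; last by rewrite pE qE cross.
rewrite !FE r0 /=; case: ifP => fp //.
have f15 : f (opt 15) by rewrite -(lab_same_circle p15).
have f1 : f (opt 1).
  rewrite -(lab_same_circle (x := corner_sw k)) //; apply: (same_circle_trans pq).
  by apply: (same_circle_trans q0); rewrite (same_circle_opt zk) // r0 rep_all_vertical.2.
rewrite [phi _ (vlab f)](_ : _ = false); last by apply/negP => /phi0P /(_ 15 isT); rewrite f15.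
(* Point 1 lies on the second strand and 15 on the first: each term of the split keeps v_+ at one of
   them. *)
rewrite [X in (X + _)%R](_ : _ = false); last first.
  apply/negP => /phi0P /(_ 1 isT); rewrite ffunE f1 andbT pE /opt cross //.
rewrite [X in (_ + X)%R](_ : _ = false) //.
by apply/negP => /phi0P /(_ 15 isT); rewrite ffunE f15 andbT qE /opt cross.
Qed.

(** The gap on the side of [j] contains exactly one of the two corners. Once [k] is undone, both
    strands run on through that gap to its other turnback, whose arc joins them. *)
Lemma twist_separates a (k : 'I_N) j : turnback a k -> turnback a j -> j != k ->
  ~~ same_circle a (pt 0 k) (pt 1 k.+1) /\
  same_circle (flip a k) (pt 0 k) (pt 1 k.+1).
Proof.
move=> zk zj jk; have kN := turnback_lt zk; have vk := vertical_flip zk.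
have [kj|kj] := ltnP k j.
  have [hi g] := gap_succ zk zj kj; have [_ zhi khi _] := g; have hiN := turnback_lt zhi.
  split.
    by apply/negP => /(in_gap_inv g); rewrite !in_gap_pt ?(ltnW kN) //; lia.
  have run i l : i < 2 -> k <= l <= hi -> same_circle (flip a k) (pt i l) (pt i hi).
    move=> i2 lb; apply: same_circle_run; try lia.
    move=> m mb; have [->|mk] := eqVneq m k; first by rewrite vk.
    by rewrite (vertical_flip_gap _ g) //; lia.
  apply: (@same_circle_trans _ _ _ (pt 0 hi)); first by apply: run; lia.
  rewrite same_circleC; apply: (@same_circle_trans _ _ _ (pt 1 hi)); first by apply: run; lia.
  rewrite same_circleC; apply: (turnback_same_circle _).1.
  by rewrite turnback_flip zhi andbT; lia.
have {}kj : j < k by lia.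
have [lo g] := gap_pred zk zj kj; have [zlo _ lok _] := g; have loN := turnback_lt zlo.
split.
  by apply/negP => /(in_gap_inv g); rewrite !in_gap_pt ?(ltnW kN) //; lia.
have run i l : i < 2 -> lo < l <= k.+1 -> same_circle (flip a k) (pt i lo.+1) (pt i l).
  move=> i2 lb; apply: same_circle_run; try lia.
  move=> m mb; have [->|mk] := eqVneq m k; first by rewrite vk.
  by rewrite (vertical_flip_gap _ g) //; lia.
apply: (@same_circle_trans _ _ _ (pt 0 lo.+1)).
  by rewrite same_circleC; apply: run; lia.
apply: (@same_circle_trans _ _ _ (pt 1 lo.+1)); last by apply: run; lia.
by apply: (turnback_same_circle _).2; rewrite turnback_flip zlo andbT; lia.
Qed.

Lemma flux_twist_merge (k : 'I_N) s j : let a := res s in let f := lab s in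
    turnback a k -> turnback a j -> j != k -> turnbacks a = (count id (posbits a)).+1 ->
  flux k s = (f (pt 0 k) || f (pt 1 k.+1)) &&
    (small (flip a k) (merged a k f) && phi (posbits a) (vlab (merged a k f))).
Proof.
move=> a f zk zj jk hc; have [pE qE] := corners_twist zk.
have [npq pq] := twist_separates zk zj jk.
rewrite merge_flux pE qE // -/a -/f /functional.
rewrite posbits_flip_twist; last by case/andP: zk.
have -> : turnbacks (flip a k) == count id (posbits a).
  by rewrite -eqSS turnbacks_flip_twist // hc.
by [].
Qed.

Lemma enclosed_leN a l : enclosed a l -> l <= N.
Proof. by move/enclosed_lt; rewrite size_beta; lia. Qed.

Lemma enclosed_lab s l : enclosed (res s) l -> lab s (pt 1 l) = lab s (pt 0 l).
Proof.
move=> el; have [lo [hi [g h]]] := gapP el; apply: lab_same_circle.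
have lN : l <= N by have := enclosed_lt el; rewrite size_beta; lia.
by apply: (gap_connected g); rewrite in_gap_pt.
Qed.

Lemma enclosed_flip a (k : 'I_N) l : enclosed (flip a k) l -> enclosed a l.
Proof.
case/enclosedP => k1 [k2 [h]]; rewrite !turnback_flip => /andP[_ z1] /andP[_ z2].
by apply/enclosedP; exists k1, k2.
Qed.

Lemma small_merged s (k : 'I_N) : let a := res s in let f := lab s in
    small a f -> f (corner_sw k) && f (corner_ne k) = false ->
  small (flip a k) (merged a k f).
Proof.
move=> a f /smallP sm fk; apply/smallP => l /enclosed_flip el.
by rewrite ffunE fk (sm _ el) if_same.
Qed.

(** Of the two merging circles the skeleton sees only that of [x], so the merge appears there as
    multiplication by v_-. *)
Lemma vlab_merged_dot s (k : 'I_N) x i k0 : let a := res s in let f := lab s in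
    turnback a k0 -> i < 18 -> same_circle a x (opt i) ->
    (forall j, j < 18 -> same_circle a (opt j) (corner_sw k) ||
       same_circle a (opt j) (corner_ne k) = same_circle a (opt j) x) ->
    f (corner_sw k) && f (corner_ne k) = false ->
  vlab (merged a k f) =
    relabel (fun j => (rep (posbits a) j != rep (posbits a) i) && nth false (vlab f) j).
Proof.
move=> a f z0 i18 xi cE fk; apply: eq_relabel => j j18.
rewrite ffunE fk cE // same_circleC (same_circle_eql _ xi) same_circleC.
by rewrite (same_circle_opt z0) // nth_relabel //; case: eqP.
Qed.

(** Outside the gap, the border that remains takes over the role of the border that is undone. *)
Lemma enclosed_flip_out a (k : 'I_N) lo hi l : gap a lo hi ->
    k = lo :> nat \/ k = hi :> nat -> enclosed a l -> ~~ (lo < l <= hi) ->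
  enclosed (flip a k) l.
Proof.
move=> [zlo zhi lohi _] kE /enclosedP[k1 [k2 [hb zk1 zk2]]] nl.
have [o zo ob] : exists2 o, turnback (flip a k) o & lo <= o <= hi.
  case: kE => kE; [exists hi|exists lo]; rewrite ?leqnn ?(ltnW lohi) // turnback_flip kE.
    by rewrite zhi neq_ltn lohi orbT.
  by rewrite zlo neq_ltn lohi.
have kb : lo <= k <= hi by case: kE => ->; rewrite leqnn (ltnW lohi).
apply/enclosedP; have [ll|ll] := leqP l lo.
  exists k1, o; split=> //; first by clear -hb ob ll; lia.
  by rewrite turnback_flip zk1 andbT; clear -hb kb ll; lia.
have {}ll : hi < l by clear -ll nl; lia.
exists o, k2; split=> //; first by clear -hb ob ll; lia.
by rewrite turnback_flip zk2 andbT; clear -hb kb ll; lia.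
Qed.

(** A gap that stays enclosed after losing a border has a further turnback beyond it, so its
    neighbour on that side was a small circle too. *)
Lemma enclosed_flip_in a (k : 'I_N) lo hi l : gap a lo hi ->
    enclosed (flip a k) l -> lo < l <= hi ->
  (k = lo :> nat -> enclosed a lo) /\ (k = hi :> nat -> enclosed a hi.+1).
Proof.
move=> g /enclosedP[k1 [k2 [hb]]].
rewrite !turnback_flip => /andP[n1 zk1] /andP[n2 zk2] lb; have [zlo zhi _ _] := g.
have [s1 _] := gap_sep g lb zk1; have [_ s2] := gap_sep g lb zk2.
case/andP: hb => /s1 b1 /s2 b2; split=> kE; rewrite kE in n1 n2; apply/enclosedP.
  by exists k1, lo; split=> //; clear -n1 b1; lia.
by exists hi, k2; split=> //; clear -n2 b2; lia.
Qed.

Section Merges.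
Variable s : state w.
Let a := res s.
Let f := lab s.
Hypothesis hc : turnbacks a = (count id (posbits a)).+1.

Lemma flux_twist_middle (k : 'I_N) i j : small a f ->
  turnback a k -> turnback a i -> turnback a j -> i < k -> k < j -> flux k s = 0%R.
Proof.
move=> /smallP sm zk zi zj ik kj; rewrite (flux_twist_merge zk zj _ hc); last by lia.
rewrite sm; last by apply/enclosedP; exists i, k; split=> //; lia.
have e : enclosed a k.+1 by apply/enclosedP; exists k, j; split=> //; lia.
by rewrite enclosed_lab // sm.
Qed.

(** The lowest turnback separates the lower end, seen by the skeleton at point 15, from a small
    circle labelled v_-. *)
Lemma flux_twist_min (k : 'I_N) : 1 < turnbacks a -> small a f ->
    turnback a k -> (forall j, turnback a j -> k <= j) ->
  flux k s = dot (posbits a) (vlab f) 15.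
Proof.
move=> z2 sm zk kmin; have [j jk zj] := turnback_other k z2.
have kj : k < j by have := kmin _ zj; lia.
rewrite (flux_twist_merge zk zj jk hc) -/a -/f.
have e : enclosed a k.+1 by apply/enclosedP; exists k, j; split=> //; lia.
have fq : f (pt 1 k.+1) = false by rewrite enclosed_lab // (smallP _ _ sm).
have [pE qE] := corners_twist zk.
have p15 := below_same_circle zk kmin.
have fk : f (corner_sw k) && f (corner_ne k) = false by rewrite qE fq andbF.
rewrite fq orbF small_merged //= (vlab_merged_dot zk _ p15) // => [|i i18].
  by rewrite /dot /vlab nth_relabel // (lab_same_circle p15); case: (f _).
by rewrite pE qE (opt_enclosed _ e) // orbF.
Qed.

Lemma flux_twist_max (k : 'I_N) : 1 < turnbacks a -> small a f ->
    turnback a k -> (forall j, turnback a j -> j <= k) ->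
  flux k s = dot (posbits a) (vlab f) 0.
Proof.
move=> z2 sm zk kmax; have [j jk zj] := turnback_other k z2.
have kj : j < k by have := kmax _ zj; lia.
rewrite (flux_twist_merge zk zj jk hc) -/a -/f.
have e : enclosed a k by apply/enclosedP; exists j, k; split=> //; lia.
have fp : f (pt 0 k) = false by rewrite (smallP _ _ sm).
have [pE qE] := corners_twist zk.
have q0 := above_same_circle zk kmax.
have fk : f (corner_sw k) && f (corner_ne k) = false by rewrite pE fp.
rewrite fp small_merged //= (vlab_merged_dot zk _ q0) // => [|i i18].
  by rewrite /dot /vlab nth_relabel // (lab_same_circle q0); case: (f _).
by rewrite pE qE (opt_enclosed _ e).
Qed.

Lemma flux_twist_far (k : 'I_N) lo hi l : gap a lo hi -> lo < l <= hi ->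
  f (pt 0 l) -> turnback a k -> k != lo :> nat -> k != hi :> nat -> flux k s = 0%R.
Proof.
move=> g lb fl zk klo khi; have [zlo zhi lohi _] := g.
rewrite (flux_twist_merge zk zlo _ hc) -/a -/f; last by rewrite eq_sym.
suff -> : small (flip a k) (merged a k f) = false by rewrite andbF.
apply/negP => /smallP/(_ l).
have el : enclosed (flip a k) l.
  by apply/enclosedP; exists lo, hi; rewrite !turnback_flip zlo zhi !(eq_sym _ (k : nat)) klo khi.
have lN : l <= N by have := enclosed_lt el; rewrite size_beta; lia.
have [pE qE] := corners_twist zk; have kN := turnback_lt zk.
have [sep1 sep2] := gap_sep g lb zk.
have out x : in_gap lo hi x = false -> same_circle a (pt 0 l) x = false.
  by move=> xg; apply/negP => /(in_gap_inv g); rewrite xg in_gap_pt // lb.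
move=> /(_ el); rewrite ffunE pE qE !out ?fl //; rewrite in_gap_pt ?(ltnW kN) //; lia.
Qed.

(* If the small circle between the turnbacks lo and hi is labelled v_+, undoing
   lo merges it into the circle below and undoing hi into the circle above, in
   both cases without any other change: the two contributions cancel. *)
Lemma flux_twist_gap (k : 'I_N) lo hi l : gap a lo hi -> lo < l <= hi ->
    f (pt 0 l) -> k = lo :> nat \/ k = hi :> nat ->
  flux k s = all (fun l' => enclosed a l' && ~~ (lo < l' <= hi) ==> ~~ f (pt 0 l')) (iota 0 T)
    && phi (posbits a) (vlab f).
Proof.
move=> g lb fl kE; have [zlo zhi lohi nz] := g.
have zk : turnback a k by case: kE => ->.
have [j zj jk] : exists2 j, turnback a j & j != k.
  by case: kE => ->; [exists hi|exists lo] => //; lia.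
have kN := turnback_lt zk; have hiN := turnback_lt zhi.
have hiT : hi < T by case/andP: zhi.
have lN : l <= N by lia.
rewrite (flux_twist_merge zk zj jk hc) -/a -/f.
have [pE qE] := corners_twist zk.
have inl : in_gap lo hi (pt 0 l) by rewrite in_gap_pt.
have fin x : in_gap lo hi x -> f x.
  by move=> xg; rewrite (lab_same_circle (gap_connected g xg inl)).
(* [c] is the corner on the other of the two merging circles *)
have [c [c' [cc gc gc']]] : exists c c', [/\ (c = corner_sw k /\ c' = corner_ne k) \/
    (c = corner_ne k /\ c' = corner_sw k), in_gap lo hi c = false & in_gap lo hi c'].
  case: kE => kE; [exists (corner_sw k), (corner_ne k)|exists (corner_ne k), (corner_sw k)];
    rewrite pE qE !in_gap_pt ?(ltnW kN) // kE; split; by [left|right|lia].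
have mgE x : merged a k f x = if in_gap lo hi x then f c else f x.
  have -> : merged a k f x = if same_circle a x c || same_circle a x c'
      then f c else f x.
    have fc' := fin _ gc'.
    rewrite ffunE; case: cc => -[eC eC']; rewrite -eC -eC' fc' ?andbT //.
    by rewrite orbC.
  case: (boolP (in_gap lo hi x)) => xg.
    by rewrite (gap_connected g xg gc') orbT.
  case: (boolP (same_circle a x c)) => [/lab_same_circle->//|_ /=].
  by case: (boolP (same_circle a x c')) => // /(in_gap_inv g); rewrite gc' (negbTE xg).
have -> : f (pt 0 k) || f (pt 1 k.+1).
  by rewrite -pE -qE; have := fin _ gc'; case: cc => -[_ ->] ->; rewrite ?orbT.
have kT : k < T by case/andP: zk.
congr (_ && phi _ _); last first.
  apply: eq_relabel => i i18; rewrite mgE.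
  case: ifP => // /(fun h => gap_connected g h inl).
  rewrite (opt_enclosed _ (l := l)) //; apply/enclosedP.
  by exists lo, hi.
(* Levels of the gap that stay enclosed now belong to the small circle that absorbed it and carry
   its label. *)
have fcE l' : enclosed (flip a k) l' -> lo < l' <= hi ->
    exists2 m, enclosed a m && ~~ (lo < m <= hi) & f (pt 0 m) = f c.
  move=> el' lb'; have [elo ehi] := enclosed_flip_in g el' lb'.
  case: cc => -[eC eC']; rewrite eC ?pE ?qE.
    case: kE => kE; last by move: gc; rewrite eC pE in_gap_pt ?(ltnW kN) //= kE leqnn lohi.
    by exists lo; rewrite ?kE // elo // ltnn.
  case: kE => kE; first by move: gc; rewrite eC qE in_gap_pt //= kE leqnn lohi.
  exists hi.+1; first by rewrite ehi // ltnn andbF.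
  by rewrite kE enclosed_lab // ehi.
apply/smallP/allP => [h l' _|h l' el].
  apply/implyP => /andP[el nl].
  have l'N := enclosed_leN el.
  have := h l'; rewrite mgE in_gap_pt // (negbTE nl) andbF => -> //.
  exact: enclosed_flip_out nl.
have l'N := enclosed_leN el.
rewrite mgE in_gap_pt //=; case: ifP => lb'.
  have [m /andP[em hm] <-] := fcE _ el lb'.
  by apply/negbTE; apply: (implyP (h m _)); rewrite ?mem_iota ?em //; exact: enclosed_lt em.
apply/negbTE; apply: (implyP (h l' _)); first by rewrite mem_iota; exact: enclosed_lt el.
by rewrite (enclosed_flip el) lb'.
Qed.

End Merges.

Lemma flux_twist s : let a := res s in let f := lab s in
    turnbacks a = (count id (posbits a)).+1 ->
  (\sum_(k < N | turnback a k) flux k s)%R = small a f && twist_term (posbits a) (vlab f).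
Proof.
move=> a f hc.
have k0P : exists k, turnback a k.
  suff : has (turnback a) (iota 0 T) by case/hasP => k _; exists k.
  by rewrite has_count -/(turnbacks a) hc.
have ubz k : turnback a k -> k <= N by move/turnback_lt; apply: ltnW.
case: (ex_minnP k0P) => lo0 zlo0 minlo; case: (ex_maxnP k0P ubz) => hi0 zhi0 maxhi.
pose lo := Ordinal (turnback_lt zlo0); pose hi := Ordinal (turnback_lt zhi0).
(* One turnback means that no positive crossing is 1-resolved, which is the saddle; with two or more
   there are small circles, and every turnback is undone by a merge. *)
have [z1|z2] := leqP (turnbacks a) 1.
  have c0 : count id (posbits a) = 0 by move: z1; rewrite hc; lia.
  have z1' : turnbacks a = 1 by rewrite hc c0.
  rewrite (bigD1 lo) //= [X in (_ + X)%R]big1 ?addr0 => [|k /andP[zk /eqP kl]].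
    rewrite flux_twist_single // -/a -/f /twist_term.
    by rewrite {2}(count_id0 c0) size_posbits eqxx.
  by case: kl; apply: val_inj; exact: (turnback_unique z1 zk zlo0).
have rn : (posbits a == nseq 5 false) = false.
  by apply/eqP => r0; move: z2; rewrite hc r0.
rewrite /twist_term rn.
have [sm|/allPn[l _]] := boolP (small a f).
  have lh : lo0 < hi0.
    have [j jl zj] := turnback_other lo0 z2; have := minlo _ zj; have := maxhi _ zj; lia.
  rewrite (bigD1 hi) //= (bigD1 lo) /=; last by rewrite zlo0 -val_eqE /=; lia.
  rewrite [X in (_ + (_ + X))%R]big1 ?addr0 => [|k].
    by rewrite flux_twist_max // flux_twist_min.
  case/andP => /andP[zk kh] kl; apply: (flux_twist_middle hc sm zk zlo0 zhi0).
    by have := minlo _ zk; rewrite -val_eqE /= in kl; lia.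
  by have := maxhi _ zk; rewrite -val_eqE /= in kh; lia.
rewrite negb_imply negbK => /andP[/gapP[l1 [l2 [g lb]]] fl].
have [zl1 zl2 l12 _] := g.
pose o1 := Ordinal (turnback_lt zl1); pose o2 := Ordinal (turnback_lt zl2).
rewrite (bigD1 o1) //= (bigD1 o2) /=; last by rewrite zl2 -val_eqE /=; lia.
rewrite (flux_twist_gap (k := o1) hc g lb fl (or_introl erefl)).
rewrite (flux_twist_gap (k := o2) hc g lb fl (or_intror erefl)).
rewrite [X in (_ + (_ + X))%R]big1 ?addr0 => [|k]; first exact: addbb.
by case/andP => /andP[zk k1] k2; apply: (flux_twist_far hc g lb fl zk).
Qed.

(** Labels are constant on circles, hence determined at the representatives; this brings every
    actual state under the finite check. *)
Lemma vlab_spread s k0 : turnback (res s) k0 ->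
  exists2 b, vlab (lab s) = spread (posbits (res s)) b &
    b \in bits (size (undup (reps (posbits (res s))))).
Proof.
set r := posbits (res s) => z0.
exists [seq lab s (opt j) | j <- undup (reps r)]; last first.
  by rewrite -(size_map (fun j => lab s (opt j))) mem_bits.
apply: eq_relabel => i i18; have [r18 rP] := rep_sound z0 i18.
have rin : rep r i \in undup (reps r).
  rewrite mem_undup /rep mem_nth //.
  have -> // : size (reps r) = 18.
  rewrite /reps; have : size (iota 0 18) = 18 by [].
  by elim: (edges r) (iota 0 18) => //= e es IH t st; apply: IH; rewrite size_map.
by rewrite (nth_map 0) ?index_mem // nth_index // (lab_same_circle rP).
Qed.

Lemma flux_total s : (\sum_(k < N | ~~ res s k) flux k s = 0)%R.
Proof.
set a := res s; set f := lab s; set r := posbits a.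
have [hc|hc] := eqVneq (turnbacks a) (count id r).+1; last first.
  by rewrite big1 // => o ao; apply: functional_count0.
have [k0 z0] : exists k, turnback a k.
  suff : has (turnback a) (iota 0 T) by case/hasP => k _; exists k.
  by rewrite has_count -/(turnbacks a) hc.
rewrite (bigID (fun k : 'I_N => k < T)) /=.
rewrite (eq_bigl (fun k : 'I_N => turnback a k)) => [|k]; last by rewrite /turnback bitE andbC.
rewrite flux_twist // -/a -/f -/r.
have kP (j : 'I_5) : T + j < N by rewrite size_beta ltn_add2l.
pose h (j : 'I_5) := Ordinal (kP j).
rewrite (reindex_onto h (fun k : 'I_N => inord (k - T))) /=; last first.
  move=> k /andP[_ Tk]; apply: val_inj => /=.
  have kN : k < T + 5 by rewrite -size_beta.
  by rewrite inordK; lia.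
rewrite (eq_bigl (fun j : 'I_5 => ~~ a (h j))) => [|j]; last first.
  rewrite -leqNgt leq_addr andbT addKn inord_val eqxx andbT //.
rewrite (eq_bigr (fun j : 'I_5 => small a f && pos_term r (vlab f) j)); last first.
  move=> j aj; exact: (flux_pos (k0 := k0)).
(* [pos_term] vanishes at crossings already 1-resolved, so the sum may run over all five, as in the
   check. *)
rewrite big_mkcond (eq_bigr (fun j : 'I_5 => small a f && pos_term r (vlab f) j)); last first.
  move=> j _; case: ifP => //; rewrite -bitE /= -nth_posbits // -/a -/r => /negbFE rj.
  by rewrite /pos_term rj andbF.
case: (small a f); last by rewrite big1.
have [b -> bP] := vlab_spread z0.
have := all_mem (all_mem skeleton_cocycle_check (posbits_in a)) bP.
lazy zeta; rewrite foldr_addb -/r => /negbTE.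
by rewrite -[iota 0 5]/(index_iota 0 5) big_mkord.
Qed.

Lemma functional_psi : functional (oriented_resolution w) [ffun=> vminus].
Proof.
have bit_or k : bit (oriented_resolution w) k = (k < T).
  rewrite /bit; case: insubP => /= [i _ <-|]; last by rewrite -leqNgt size_beta; lia.
  by rewrite ffunE (crossingE i).2 -ltnNge.
have nz k : turnback (oriented_resolution w) k = false by rewrite /turnback bit_or andbN.
have pb : posbits (oriented_resolution w) = nseq 5 false.
  by rewrite /posbits /= !bit_or !ltnNge !leq_addr.
rewrite /functional pb /turnbacks (eq_count nz) count_pred0 /=.
apply/andP; split; first by apply/smallP => l /enclosedP[? [? [_]]]; rewrite nz.
by rewrite phi0; apply/eqP/eq_relabel => i _; rewrite ffunE.
Qed.

End ClosedBraid.

Local Open Scope ring_scope.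

Theorem proposition2p11 : forall n : nat, (1 <= n)%N -> psi (beta n) <> 0.
Proof.
by move=> n _; exact: psi_neq0_of_functional (@flux_total n) (functional_psi n).
Qed.
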